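(* Let $\{x^k\}$ be generated by the algorithm PGiPN described in the context with $\epsilon=0$, assume $x^k\ne\bar x^k$ for all $k$, let $\Gamma(x^0)$ be the set of accumulation points of $\{x^k\}$, let $\Pi_*$ be the eventual common value of $\Pi(x^k)$ (see context), and let $\phi=f+\delta_{\Pi_*}$. Assume: (A1) $\nabla^2f$ is locally Lipschitz continuous on an open set containing $\Gamma(x^0)$; (A2) $0\in\nabla f(x^* )+\mathrm{ri}(\mathcal{N}_{\Pi_*}(x^* ))$ for all $x^*\in\Gamma(x^0)$; (A3) for every sufficiently large $k$ there is $\xi_k\in\mathcal{N}_{\Pi_*}(x^k)$ such that $\liminf_{k\to\infty}\frac{-\langle\nabla f(x^k)+\xi_k,d^k\rangle}{\|\nabla f(x^k)+\xi_k\|\|d^k\|}>0$; and assume $\phi$ is a KL function. Then $\sum_{k=1}^\infty\|x^{k+1}-x^k\|<\infty$, and consequently $\{x^k\}$ converges to an $L$-stationary point of $\min_x F(x)$.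
   Context: Setting: $B\in\mathbb{R}^{p\times n}$, $\lambda_1,\lambda_2>0$, $l\le0\le u$ in $\mathbb{R}^n$, $f:\mathbb{R}^n\to\mathbb{R}$ twice continuously differentiable, $\Omega=\{x:l\le x\le u\}$, $g(x)=\lambda_1\|Bx\|_0+\lambda_2\|x\|_0+\delta_\Omega(x)$ ($\|\cdot\|_0$ = number of nonzeros, $\delta_C$ indicator of $C$), $F=f+g$; $\mathrm{supp}(x)=\{i:x_i\ne0\}$; $\mathrm{prox}_{\mu g}(z)=\arg\min_x\{\frac1{2\mu}\|x-z\|^2+g(x)\}$; $\Pi(z)=\{x\in\Omega:\mathrm{supp}(x)\subset\mathrm{supp}(z),\mathrm{supp}(Bx)\subset\mathrm{supp}(Bz)\}$; $\mathcal{N}_C$ is the normal cone and $\mathrm{ri}$ the relative interior. A point $x$ is $L$-stationary for $\min F$ if $x\in\mathrm{prox}_{\mu^{-1}g}(x-\mu^{-1}\nabla f(x))$ for some $\mu>0$. KL property: for $\eta>0$ let $\Upsilon_\eta$ be the set of continuous concave $\varphi:[0,\eta)\to\mathbb{R}_+$, continuously differentiable on $(0,\eta)$, with $\varphi(0)=0$ and $\varphi'>0$ on $(0,\eta)$. A proper $h$ has the KL property at $\bar x\in\mathrm{dom}\,\partial h$ if there are $\eta\in(0,\infty]$, a neighborhood $\mathcal U$ of $\bar x$ and $\varphi\in\Upsilon_\eta$ with $\varphi'(h(x)-h(\bar x))\,\mathrm{dist}(0,\partial h(x))\ge1$ for all $x\in\mathcal U$ with $h(\bar x)<h(x)<h(\bar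 x)+\eta$; $h$ is a KL function if this holds at every point of $\mathrm{dom}\,\partial h$ ($\partial$ = limiting subdifferential). Algorithm PGiPN: parameters $\epsilon\ge0$, $\mu_{\max}>\mu_{\min}>0$, $\tau>1$, $\alpha>0$, $b_1>0$, $b_2\ge1$, $\varrho\in(0,\frac12)$, $\sigma\in(0,\frac12)$, $\varsigma\in(\sigma,1]$, $\beta\in(0,1)$, $x^0\in\Omega$. Iteration $k$: (PG step) pick $\mu_k\in[\mu_{\min},\mu_{\max}]$; let $m_k$ be the smallest nonnegative integer $m$ such that some $\bar x^k\in\mathrm{prox}_{(\mu_k\tau^m)^{-1}g}(x^k-(\mu_k\tau^m)^{-1}\nabla f(x^k))$ satisfies $F(\bar x^k)\le F(x^k)-\frac\alpha2\|x^k-\bar x^k\|^2$; set $\bar\mu_k=\mu_k\tau^{m_k}$. If $\bar\mu_k\|x^k-\bar x^k\|\le\epsilon$, stop. If $\mathrm{supp}(x^k)=\mathrm{supp}(\bar x^k)$ and $\mathrm{supp}(Bx^k)=\mathrm{supp}(B\bar x^k)$ go to the Newton step, else set $x^{k+1}=\bar x^k$. (Newton step) let $\Pi_k=\Pi(x^k)$, $\Theta_k(x)=f(x^k)+\langle\nabla f(x^k),x-x^k\rangle+\frac12\langle x-x^k,G_k(x-x^k)\rangle+\delta_{\Pi_k}(x)$; find $y^k$ with $\Theta_k(y^k)\le\Theta_k(x^k)$ and $\mathrm{dist}(0,\partial\Theta_k(y^k))\le\frac{\min\{\bar\mu_k^{-1},1\}}2\min\{\|\bar\mu_k(x^k-\bar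 x^k)\|,\|\bar\mu_k(x^k-\bar x^k)\|^{1+\varsigma}\}$; set $d^k=y^k-x^k$; let $t_k$ be the smallest nonnegative integer $t$ with $f(x^k+\beta^td^k)\le f(x^k)+\varrho\beta^t\langle\nabla f(x^k),d^k\rangle$; $\alpha_k=\beta^{t_k}$, $x^{k+1}=x^k+\alpha_kd^k$. Choice of $G_k$ (with $e_k=b_1\|\bar\mu_k(x^k-\bar x^k)\|^\sigma$): either $G_k=\nabla^2f(x^k)+(b_2[-\lambda_{\min}(\nabla^2f(x^k))]_++e_k)I$; or, when $f(x)=h(Ax-b)$ with $h$ twice continuously differentiable and separable, $G_k=\nabla^2f(x^k)+b_2[-\lambda_{\min}(\nabla^2h(Ax^k-b))]_+A^\top A+e_kI$ or $G_k=A^\top[\nabla^2h(Ax^k-b)]_+A+e_kI$, where $t_+=\max\{t,0\}$ and $[D]_+$ replaces negative diagonal entries of the diagonal matrix $D$ by $0$. For such a run there is $k_0$ such that for all $k>k_0$ the Newton step is executed and the polyhedral sets $\Pi(x^k)$ all coincide; $\Pi_*$ denotes this common set. *)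

(* Defs.v *)
From HB Require Import structures.
From mathcomp Require Import all_boot all_order all_algebra.
From mathcomp Require Import all_classical all_reals all_analysis.
Set Implicit Arguments. Unset Strict Implicit. Unset Printing Implicit Defensive.
Import Order.TTheory GRing.Theory Num.Theory.
Import numFieldNormedType.Exports.
Local Open Scope classical_set_scope.
Local Open Scope ring_scope.

Section Defs.
Variable R : realType.

Definition dotp {n} (u v : 'cV[R]_n) : R := \sum_i u i 0 * v i 0.
Definition enorm {n} (u : 'cV[R]_n) : R := Num.sqrt (dotp u u).
(* Frobenius norm of a matrix (any matrix norm gives the same Lipschitz notion) *)
Definition fnorm {n m} (M : 'M[R]_(n, m)) : R := Num.sqrt (\sum_i \sum_j M i j ^+ 2).

Definition vconv {n} (xs : nat -> 'cV[R]_n) (x : 'cV[R]_n) : Prop :=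
  forall e : R, 0 < e -> exists N, forall k, (N <= k)%N -> enorm (xs k - x) < e.
Definition rconv (s : nat -> R) (a : R) : Prop :=
  forall e : R, 0 < e -> exists N, forall k, (N <= k)%N -> `|s k - a| < e.

Definition accum_points {n} (xs : nat -> 'cV[R]_n) : set 'cV[R]_n :=
  [set z | forall e : R, 0 < e -> forall N, exists k, (N <= k)%N /\ enorm (xs k - z) < e].

Definition vopen {n} (O : set 'cV[R]_n) : Prop :=
  forall z, O z -> exists r : R, 0 < r /\ forall y, enorm (y - z) < r -> O y.

Definition has_grad {n} (f : 'cV[R]_n -> R) (g : 'cV[R]_n -> 'cV[R]_n) : Prop :=
  forall x e, 0 < e -> exists d : R, 0 < d /\ forall h, enorm h < d ->
    `|f (x + h) - f x - dotp (g x) h| <= e * enorm h.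
Definition has_jac {n} (g : 'cV[R]_n -> 'cV[R]_n) (J : 'cV[R]_n -> 'M[R]_n) : Prop :=
  forall x e, 0 < e -> exists d : R, 0 < d /\ forall h, enorm h < d ->
    enorm (g (x + h) - g x - J x *m h) <= e * enorm h.
Definition mcont {n} (J : 'cV[R]_n -> 'M[R]_n) : Prop :=
  forall x e, 0 < e -> exists d : R, 0 < d /\ forall y, enorm (y - x) < d ->
    fnorm (J y - J x) < e.
Definition C2_with {n} (f : 'cV[R]_n -> R) g H : Prop :=
  has_grad f g /\ has_jac g H /\ mcont H.

Definition loc_lip_near {n} (H : 'cV[R]_n -> 'M[R]_n) (S : set 'cV[R]_n) : Prop :=
  exists O : set 'cV[R]_n, vopen O /\ S `<=` O /\
    forall z, O z -> exists r L : R, 0 < r /\ forall y y',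
      enorm (y - z) < r -> enorm (y' - z) < r -> fnorm (H y - H y') <= L * enorm (y - y').

Definition normal_cone {n} (C : set 'cV[R]_n) (x : 'cV[R]_n) : set 'cV[R]_n :=
  [set v | C x /\ forall y, C y -> dotp v (y - x) <= 0].
Definition aff_hull {n} (S : set 'cV[R]_n) : set 'cV[R]_n :=
  [set y | exists (m : nat) (pts : 'I_m -> 'cV[R]_n) (w : 'I_m -> R),
     (forall i, S (pts i)) /\ \sum_i w i = 1 /\ y = \sum_i w i *: pts i].
Definition rel_int {n} (S : set 'cV[R]_n) : set 'cV[R]_n :=
  [set x | S x /\ exists r : R, 0 < r /\
     forall y, aff_hull S y -> enorm (y - x) < r -> S y].

Definition frechet_sub {n} (h : 'cV[R]_n -> \bar R) (x v : 'cV[R]_n) : Prop :=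
  h x \is a fin_num /\
  forall e : R, 0 < e -> exists d : R, 0 < d /\ forall y, enorm (y - x) < d ->
    (h x + (dotp v (y - x) - e * enorm (y - x))%:E <= h y)%E.
Definition lim_sub {n} (h : 'cV[R]_n -> \bar R) (x : 'cV[R]_n) : set 'cV[R]_n :=
  [set v | h x \is a fin_num /\
     exists xs vs : nat -> 'cV[R]_n, vconv xs x /\ vconv vs v /\
       (forall k, frechet_sub h (xs k) (vs k)) /\
       rconv (fun k => fine (h (xs k))) (fine (h x))].
(* dist(0, S) (= +oo for empty S) *)
Definition dist0 {n} (S : set 'cV[R]_n) : \bar R :=
  ereal_inf [set (enorm v)%:E | v in S].

Definition Upsilon (eta : \bar R) (phi : R -> R) : Prop :=
  let I := [set t : R | 0 <= t /\ (t%:E < eta)%E] in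
  let J := [set t : R | 0 < t /\ (t%:E < eta)%E] in
  {within I, continuous phi} /\
  (forall s t a, I s -> I t -> 0 <= a <= 1 ->
     a * phi s + (1 - a) * phi t <= phi (a * s + (1 - a) * t)) /\
  (forall t, I t -> 0 <= phi t) /\
  (forall t, J t -> derivable phi t 1) /\
  {within J, continuous (derive1 phi)} /\
  phi 0 = 0 /\
  (forall t, J t -> 0 < derive1 phi t).

Definition KL_at {n} (h : 'cV[R]_n -> \bar R) (xb : 'cV[R]_n) : Prop :=
  exists (eta : \bar R) (r : R) (phi : R -> R),
    (0 < eta)%E /\ 0 < r /\ Upsilon eta phi /\
    forall x, enorm (x - xb) < r -> (h xb < h x)%E -> (h x < h xb + eta)%E ->
      (1 <= (derive1 phi (fine (h x - h xb)))%:E * dist0 (lim_sub h x))%E.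

Definition KL_function {n} (h : 'cV[R]_n -> \bar R) : Prop :=
  forall xb, (exists v, lim_sub h xb v) -> KL_at h xb.

Definition supp {n} (x : 'cV[R]_n) : {set 'I_n} := [set i | x i 0 != 0].
Definition l0 {n} (x : 'cV[R]_n) : R := #|supp x|%:R.

Definition box {n} (l u : 'cV[R]_n) : set 'cV[R]_n :=
  [set x | forall i, l i 0 <= x i 0 <= u i 0].

Definition gfun {n p} (B : 'M[R]_(p, n)) (lam1 lam2 : R) (l u : 'cV[R]_n)
  (x : 'cV[R]_n) : \bar R :=
  if x \in box l u then (lam1 * l0 (B *m x) + lam2 * l0 x)%:E else +oo%E.

Definition prox_inv (mu : R) {n} (g : 'cV[R]_n -> \bar R) (z : 'cV[R]_n) : set 'cV[R]_n :=
  [set x | forall x', ((mu / 2 * enorm (x - z) ^+ 2)%:E + g x <=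
                       (mu / 2 * enorm (x' - z) ^+ 2)%:E + g x')%E].

Definition Lstationary {n} (f : 'cV[R]_n -> R) (gradf : 'cV[R]_n -> 'cV[R]_n)
  (g : 'cV[R]_n -> \bar R) (x : 'cV[R]_n) : Prop :=
  exists mu : R, 0 < mu /\ prox_inv mu g (x - mu^-1 *: gradf x) x.

Definition PiSet {n p} (B : 'M[R]_(p, n)) (l u : 'cV[R]_n) (z : 'cV[R]_n) : set 'cV[R]_n :=
  [set x | box l u x /\ supp x \subset supp z /\ supp (B *m x) \subset supp (B *m z)].

Definition indic_plus {n} (C : set 'cV[R]_n) (q : 'cV[R]_n -> R) (x : 'cV[R]_n) : \bar R :=
  if x \in C then (q x)%:E else +oo%E.

Definition is_lmin {n} (M : 'M[R]_n) (a : R) : Prop :=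
  eigenvalue M a /\ forall b, eigenvalue M b -> a <= b.

Definition PGiPN_run {n p} (B : 'M[R]_(p, n)) (lam1 lam2 : R) (l u : 'cV[R]_n)
  (f : 'cV[R]_n -> R) (gradf : 'cV[R]_n -> 'cV[R]_n)
  (mumin mumax tau alpha rho varsigma beta : R)
  (x xbar y d : nat -> 'cV[R]_n) (mu mubar : nat -> R) (mm tt : nat -> nat)
  (G : nat -> 'M[R]_n) : Prop :=
  let g := gfun B lam1 lam2 l u in
  let F := fun z => ((f z)%:E + g z)%E in
  let PGok := fun k (m : nat) z =>
    prox_inv (mu k * tau ^+ m) g (x k - (mu k * tau ^+ m)^-1 *: gradf (x k)) z /\
    (F z <= F (x k) - (alpha / 2 * enorm (x k - z) ^+ 2)%:E)%E in
  box l u (x 0%N) /\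
  forall k : nat,
    [/\ mumin <= mu k <= mumax,
        PGok k (mm k) (xbar k),
        (forall m, (m < mm k)%N -> ~ exists z, PGok k m z),
        mubar k = mu k * tau ^+ mm k &
        (if (supp (x k) == supp (xbar k)) && (supp (B *m x k) == supp (B *m xbar k))
         then
           let r := mubar k *: (x k - xbar k) in
           let Theta := indic_plus (PiSet B l u (x k)) (fun z =>
                 f (x k) + dotp (gradf (x k)) (z - x k)
                 + 1 / 2 * dotp (z - x k) (G k *m (z - x k))) in
           let LS := fun t : nat =>
                 f (x k + beta ^+ t *: d k) <= f (x k) + rho * beta ^+ t * dotp (gradf (x k)) (d k) in
           [/\ (Theta (y k) <= Theta (x k))%E,
               (dist0 (lim_sub Theta (y k)) <=
                  (Num.min (mubar k)^-1 1 / 2 *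
                   Num.min (enorm r) (powR (enorm r) (1 + varsigma)))%:E)%E,
               d k = y k - x k,
               LS (tt k) /\ (forall t, (t < tt k)%N -> ~ LS t) &
               x k.+1 = x k + beta ^+ tt k *: d k]
         else x k.+1 = xbar k)].

Definition ek (b1 sigma : R) {n} (x xbar : nat -> 'cV[R]_n) (mubar : nat -> R) (k : nat) : R :=
  b1 * powR (enorm (mubar k *: (x k - xbar k))) sigma.

Definition Gchoice1 {n} (hessf : 'cV[R]_n -> 'M[R]_n) (b1 b2 sigma : R)
  (x xbar : nat -> 'cV[R]_n) (mubar : nat -> R) (G : nat -> 'M[R]_n) : Prop :=
  forall k, exists a, is_lmin (hessf (x k)) a /\
    G k = hessf (x k) + (b2 * Num.max (- a) 0 + ek b1 sigma x xbar mubar k)%:M.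

Definition sep_composite {n q} (f : 'cV[R]_n -> R) (A : 'M[R]_(q, n)) (b : 'cV[R]_q)
  (hs hs1 hs2 : 'I_q -> R -> R) : Prop :=
  (forall x, f x = \sum_i hs i ((A *m x - b) i 0)) /\
  (forall i (t : R), is_derive t (1 : R) (hs i) (hs1 i t)) /\
  (forall i (t : R), is_derive t (1 : R) (hs1 i) (hs2 i t)) /\
  (forall i, continuous (hs2 i)).

Definition hessh {q} (hs2 : 'I_q -> R -> R) (z : 'cV[R]_q) : 'M[R]_q :=
  diag_mx (\row_i hs2 i (z i 0)).
Definition hessh_plus {q} (hs2 : 'I_q -> R -> R) (z : 'cV[R]_q) : 'M[R]_q :=
  diag_mx (\row_i Num.max (hs2 i (z i 0)) 0).

Definition Gchoice2 {n q} (hessf : 'cV[R]_n -> 'M[R]_n) (A : 'M[R]_(q, n)) (b : 'cV[R]_q)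
  (hs2 : 'I_q -> R -> R) (b1 b2 sigma : R)
  (x xbar : nat -> 'cV[R]_n) (mubar : nat -> R) (G : nat -> 'M[R]_n) : Prop :=
  forall k, exists a, is_lmin (hessh hs2 (A *m x k - b)) a /\
    G k = hessf (x k) + (b2 * Num.max (- a) 0) *: (A^T *m A)
          + (ek b1 sigma x xbar mubar k)%:M.

Definition Gchoice3 {n q} (A : 'M[R]_(q, n)) (b : 'cV[R]_q)
  (hs2 : 'I_q -> R -> R) (b1 sigma : R)
  (x xbar : nat -> 'cV[R]_n) (mubar : nat -> R) (G : nat -> 'M[R]_n) : Prop :=
  forall k, G k = A^T *m hessh_plus hs2 (A *m x k - b) *m A
                  + (ek b1 sigma x xbar mubar k)%:M.

End Defs.

(* Main.v *)
(* Write d for the Newton direction and r for the scaled proximal-gradient residual.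
   Since [PiSet x] determines the supports of [x] and [B x], its eventual constancy
   forces every late iteration to be a Newton step.  Monotonicity of the normal cone,
   applied to the optimality conditions of the proximal and of the Newton subproblem,
   gives |r| <= c|d| and e_k |d| <= c|r| with e_k = b1 |r|^sigma; together with the
   backtracking bound on the step length and the descent of f, this yields r -> 0 and
   then d -> 0 because sigma < 1.  Near an accumulation point x* the Hessian is
   Lipschitz, and sigma < 1/2 makes e_k|d|^2 dominate the cubic Taylor remainder, so
   the unit step is accepted.  Late iterates near x* are therefore solutions of Newton
   subproblems, hence approximately stationary, and strict complementarity (A2) puts
   them all on the face of x*.  Consequently <xi_k, d_k> >= 0, the angle condition
   (A3) turns the Armijo decrease into a multiple of |grad f(x_k) + xi_k| |x_{k+1} - x_k|,
   and the Kurdyka-Lojasiewicz inequality at the single point x* bounds the length of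
   the path and traps it near x*. *)
Require Import Defs.
From HB Require Import structures.
From mathcomp Require Import all_boot all_order all_algebra.
From mathcomp Require Import all_classical all_reals all_analysis.
From mathcomp Require Import ring lra.
Set Implicit Arguments. Unset Strict Implicit. Unset Printing Implicit Defensive.
Import Order.TTheory GRing.Theory Num.Theory.
Import numFieldNormedType.Exports.
Local Open Scope classical_set_scope.
Local Open Scope ring_scope.

(** * Euclidean space *)

(** Only values, residuals and directions are controlled without that proviso; the trapping argument
    finally removes it.

    The normals [xi k] of (A3) are arbitrary, so they tell nothing about the face of [x k]. The
    Newton point [y k] does carry an informative normal, [eta - g - G d], which is close to [- g xs]
    when [x k] is close to [xs]. The face is therefore identified at [y k] and handed to [x k.+1] by
    the unit step. A normal cone of [PiSet] depends only on the active bounds, so [xi k] is then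
    normal at [y k] too, which is the source of the sign of [<xi_k, d_k>].

    The matrices [G k] have no uniform positive lower bound, only [e_k], which vanishes with the
    residual; this is why errors are compared through powers of the residual. The three choices of
    [G] enter only through [newton_matrix_spec]. L-stationarity of the limit rests on the lower
    semicontinuity of the support counts. *)

Section Euclid.
Context {R : realType}.

Section Dot.
Context {n : nat}.
Implicit Types (u v w : 'cV[R]_n) (a : R).

Lemma dotpE u v : dotp u v = (u^T *m v) 0 0.
Proof. by rewrite mxE; apply: eq_bigr => i _; rewrite mxE. Qed.

Lemma dotpC u v : dotp u v = dotp v u.
Proof. by apply: eq_bigr => i _; rewrite mulrC. Qed.

Lemma dotpDl u v w : dotp (u + v) w = dotp u w + dotp v w.
Proof. by rewrite !dotpE linearD mulmxDl mxE. Qed.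

Lemma dotpDr u v w : dotp u (v + w) = dotp u v + dotp u w.
Proof. by rewrite !dotpE mulmxDr mxE. Qed.

Lemma dotpZl a u v : dotp (a *: u) v = a * dotp u v.
Proof. by rewrite !dotpE linearZ -scalemxAl mxE. Qed.

Lemma dotpZr a u v : dotp u (a *: v) = a * dotp u v.
Proof. by rewrite !dotpE -scalemxAr mxE. Qed.

Lemma dotpNl u v : dotp (- u) v = - dotp u v.
Proof. by rewrite -scaleN1r dotpZl mulN1r. Qed.

Lemma dotpNr u v : dotp u (- v) = - dotp u v.
Proof. by rewrite -scaleN1r dotpZr mulN1r. Qed.

Lemma dotpBl u v w : dotp (u - v) w = dotp u w - dotp v w.
Proof. by rewrite dotpDl dotpNl. Qed.

Lemma dotp0l u : dotp 0 u = 0.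
Proof. by rewrite -(scale0r 0) dotpZl mul0r. Qed.

Lemma dotp0r u : dotp u 0 = 0.
Proof. by rewrite dotpC dotp0l. Qed.

Definition dotp_lin := (dotpDl, dotpDr, dotpNl, dotpNr, dotpZl, dotpZr).

Lemma dotp_ge0 u : 0 <= dotp u u.
Proof. by apply: sumr_ge0 => i _; rewrite -expr2 sqr_ge0. Qed.

Lemma dotp_eq0 u : dotp u u = 0 -> u = 0.
Proof.
move=> /eqP; rewrite psumr_eq0 => [/allP uu0|i _]; last by rewrite -expr2 sqr_ge0.
apply/matrixP => i j; rewrite ord1 mxE; have := uu0 i (mem_index_enum i).
by rewrite implyTb -expr2 sqrf_eq0 => /eqP.
Qed.

Lemma enorm_ge0 u : 0 <= enorm u.
Proof. exact: sqrtr_ge0. Qed.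

Lemma enorm_sqr u : enorm u ^+ 2 = dotp u u.
Proof. by rewrite sqr_sqrtr// dotp_ge0. Qed.

Lemma enorm_eq0 u : enorm u = 0 -> u = 0.
Proof. by move=> u0; apply: dotp_eq0; rewrite -enorm_sqr u0 expr0n. Qed.

Lemma enorm_gt0 u : u <> 0 -> 0 < enorm u.
Proof.
by move=> u0; rewrite lt0r enorm_ge0 andbT; apply/eqP => /enorm_eq0.
Qed.

Lemma enorm0 : enorm (0 : 'cV[R]_n) = 0.
Proof. by rewrite /enorm dotp0l sqrtr0. Qed.

Lemma enormZ a u : enorm (a *: u) = `|a| * enorm u.
Proof.
by rewrite /enorm dotpZl dotpZr mulrA -expr2 sqrtrM ?sqr_ge0// sqrtr_sqr.
Qed.

Lemma enormN u : enorm (- u) = enorm u.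
Proof. by rewrite -scaleN1r enormZ normrN1 mul1r. Qed.

Lemma enormB u v : enorm (u - v) = enorm (v - u).
Proof. by rewrite -enormN opprB. Qed.

Lemma ler_enorm_sqr u (c : R) : 0 <= c -> dotp u u <= c ^+ 2 -> enorm u <= c.
Proof.
by move=> c0 uc; rewrite -(ler_pXn2r (n := 2)) ?nnegrE ?enorm_ge0// enorm_sqr.
Qed.

(** Cauchy-Schwarz, by expanding the square of [enorm v *: u - enorm u *: v]. *)
Lemma dotp_le u v : dotp u v <= enorm u * enorm v.
Proof.
have [/enorm_eq0 ->|/eqP/[dup] u0] := eqVneq (enorm u) 0.
  by rewrite dotp0l mulr_ge0 ?enorm_ge0.
have ug : 0 < enorm u by rewrite lt0r; apply/andP; split; [apply/eqP|exact: enorm_ge0].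
have := dotp_ge0 (enorm v *: u - enorm u *: v).
rewrite !dotp_lin (dotpC v u) -!enorm_sqr => H _.
have [/enorm_eq0 ->|/eqP v0] := eqVneq (enorm v) 0.
  by rewrite dotp0r mulr_ge0 ?enorm_ge0.
have vg : 0 < enorm v by rewrite lt0r; apply/andP; split; [apply/eqP|exact: enorm_ge0].
have : 0 <= (2 * (enorm u * enorm v)) * (enorm u * enorm v - dotp u v) by lra.
by rewrite pmulr_rge0 ?subr_ge0// !mulr_gt0.
Qed.

Lemma dotp_ge u v : - (enorm u * enorm v) <= dotp u v.
Proof. by rewrite lerNl -dotpNl -(enormN u) dotp_le. Qed.

Lemma dotp_abs u v : `|dotp u v| <= enorm u * enorm v.
Proof. by rewrite ler_norml dotp_ge dotp_le. Qed.

Lemma enormD u v : enorm (u + v) <= enorm u + enorm v.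
Proof.
apply: ler_enorm_sqr; first by rewrite addr_ge0 ?enorm_ge0.
rewrite !dotp_lin (dotpC v u) -!enorm_sqr sqrrD.
have := dotp_le u v; lra.
Qed.

Lemma enormDB u v w : enorm (u - w) <= enorm (u - v) + enorm (v - w).
Proof. by rewrite (le_trans _ (enormD _ _))// addrA subrK. Qed.

Lemma coord_le_enorm u i : `|u i 0| <= enorm u.
Proof.
rewrite -sqrtr_sqr ler_sqrt ?dotp_ge0// /dotp (bigD1 i)//= -expr2 lerDl.
by apply: sumr_ge0 => j _; rewrite -expr2 sqr_ge0.
Qed.

Lemma enorm_lt_coord (e : R) : 0 < e ->
  exists2 d : R, 0 < d & forall u, (forall i, `|u i 0| < d) -> enorm u < e.
Proof.
(* Dividing by [n.+1] covers dimension zero, and [n < n.+1 ^ 2] makes the final bound strict. *)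
move=> e0; exists (e / n.+1%:R) => [|u ui]; first by rewrite divr_gt0.
have [->|/eqP/enorm_gt0 u0] := eqVneq u 0; first by rewrite enorm0.
rewrite -(ltr_pXn2r (n := 2)) ?nnegrE ?enorm_ge0 ?(ltW e0)// enorm_sqr.
have en0 : 0 < e / n.+1%:R by rewrite divr_gt0.
have : dotp u u <= \sum_(i < n) (e / n.+1%:R) ^+ 2.
  apply: ler_sum => i _; rewrite -expr2 -real_normK ?num_real//.
  by rewrite ler_pXn2r ?nnegrE ?(ltW en0)// ltW.
rewrite sumr_const card_ord => /le_lt_trans; apply.
rewrite expr_div_n -[X in X < _]mulr_natl mulrCA gtr_pMr ?exprn_gt0//.
rewrite ltr_pdivrMr ?exprn_gt0// mul1r -natrX ltr_nat.
by rewrite -mulnn leq_pmulr.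
Qed.

End Dot.

Lemma dotp_adj {m n} (M : 'M[R]_(m, n)) u v : dotp (M *m u) v = dotp u (M^T *m v).
Proof. by rewrite !dotpE trmx_mul mulmxA. Qed.

Lemma fnorm_ge0 {n m} (M : 'M[R]_(n, m)) : 0 <= fnorm M.
Proof. exact: sqrtr_ge0. Qed.

Lemma enorm_mulmx {n m} (M : 'M[R]_(n, m)) v : enorm (M *m v) <= fnorm M * enorm v.
Proof.
apply: ler_enorm_sqr; first by rewrite mulr_ge0 ?fnorm_ge0 ?enorm_ge0.
rewrite exprMn sqr_sqrtr; last first.
  by apply: sumr_ge0 => i _; apply: sumr_ge0 => j _; rewrite sqr_ge0.
rewrite mulr_suml; apply: ler_sum => i _; rewrite -expr2.
have -> : (M *m v) i 0 = dotp (row i M)^T v.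
  by rewrite dotpE trmxK -row_mul [RHS]mxE.
have -> : \sum_j M i j ^+ 2 = enorm (row i M)^T ^+ 2.
  by rewrite enorm_sqr; apply: eq_bigr => j _; rewrite !mxE expr2.
rewrite -exprMn -real_normK ?num_real//.
by rewrite ler_pXn2r ?nnegrE ?mulr_ge0 ?enorm_ge0// dotp_abs.
Qed.

End Euclid.

(** * Accumulation points, local-to-global bounds and minimizers in a box *)

Section Compactness.
Context {R : realType} {n : nat}.
Implicit Types (l u z : 'cV[R]_n) (C : set 'cV[R]_n).

Definition vclosed C := forall z : 'cV[R]_n,
  (forall e : R, 0 < e -> exists2 y, C y & enorm (y - z) < e) -> C z.

Definition vconvex C := forall (y z : 'cV[R]_n) (t : R),
  C y -> C z -> 0 <= t <= 1 -> C (y + t *: (z - y)).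

Lemma box_closed l u : vclosed (box l u).
Proof.
move=> z zC i; apply/andP; split; rewrite leNgt; apply/negP => H.
- have [y /(_ i)/andP[ly _]] := zC (l i 0 - z i 0) ltac:(by rewrite subr_gt0).
  apply/negP; rewrite -leNgt (le_trans _ (coord_le_enorm _ i))// !mxE.
  by rewrite (le_trans _ (ler_norm _))// lerB.
- have [y /(_ i)/andP[_ yu]] := zC (z i 0 - u i 0) ltac:(by rewrite subr_gt0).
  apply/negP; rewrite -leNgt (le_trans _ (coord_le_enorm _ i))// !mxE distrC.
  by rewrite (le_trans _ (ler_norm _))// lerB.
Qed.

(** Bolzano-Weierstrass. A product of segments is compact in the space of row vectors with
    coordinatewise balls; transposition and [enorm_lt_coord] carry the cluster point back to the
    Euclidean setting. *)
Lemma bounded_accum_points l u (xs : nat -> 'cV[R]_n) :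
  (forall k, box l u (xs k)) -> accum_points xs !=set0.
Proof.
move=> xlu; pose A i := `[l i 0, u i 0]%classic.
have cA : compact [set v : 'rV[R]_n | forall i, A i (v ord0 i)].
  by apply: rV_compact => i; exact: segment_compact.
pose ys : nat -> 'rV[R]_n := fun k => (xs k)^T.
have ysA : (ys @ \oo) [set v : 'rV[R]_n | forall i, A i (v ord0 i)].
  exists 0%N => // k _ i /=; rewrite /A/= in_itv/= mxE; exact: xlu.
have [v [_ vcl]] := cA (ys @ \oo) (fmap_proper_filter _ _) ysA.
exists v^T => e e0 N.
have [d d0 dP] := enorm_lt_coord (n := n) e0.
have [_ [[k Nk <-] vy]] := vcl (ys @` [set k | (N <= k)%N]) (ball v d)
  ltac:(by exists N => // k Nk; exists k) (nbhsx_ballx v d d0).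
exists k; split=> //; apply: dP => i; rewrite !mxE distrC.
by case: vy => _ /(_ ord0 i); rewrite /ys /ball/= !mxE.
Qed.

Lemma box_accum_points l u (xs : nat -> 'cV[R]_n) z :
  (forall k, box l u (xs k)) -> accum_points xs z -> box l u z.
Proof.
move=> xlu xz; apply: box_closed => e e0.
by have [k [_ ?]] := xz e e0 0%N; exists (xs k).
Qed.

(* [Q x M] reads "the quantity of interest at [x] is at most [M]". *)
Lemma locally_bounded_box l u (Q : 'cV[R]_n -> R -> Prop) :
  (forall x M M', M <= M' -> Q x M -> Q x M') ->
  (forall z, box l u z -> exists d M : R, 0 < d /\
     forall y, box l u y -> enorm (y - z) < d -> Q y M) ->
  exists2 M : R, 0 < M & forall y, box l u y -> Q y M.
Proof.
move=> Qmon Qloc; apply: contrapT => /forall2NP noM.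
(* Otherwise some [xs k] violates the bound [k + 1] for every [k]; the local bound at an
   accumulation point of these points is contradicted as soon as [k] exceeds it. *)
have ex k : exists y, box l u y /\ ~ Q y k.+1%:R.
  have [|nQ] := noM k.+1%:R; first by rewrite ltr0n.
  apply: contrapT => /forallNP H; apply: nQ => y yB.
  by apply: contrapT => nq; exact: (H y).
have [xs xsP] := choice ex.
have [z zacc] := bounded_accum_points (fun k => (xsP k).1).
have [d [M [d0 QM]]] := Qloc z (box_accum_points (fun k => (xsP k).1) zacc).
have [k [kM kz]] := zacc d d0 (Num.bound `|M|).
apply: (xsP k).2; apply: Qmon (QM _ (xsP k).1 kz).
rewrite (le_trans (ler_norm M))// ltW// (lt_le_trans (archi_boundP _))//.
by rewrite ler_nat (leq_trans kM).
Qed.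

Definition vcontinuous_at (q : 'cV[R]_n -> R) z := forall e : R, 0 < e ->
  exists2 d : R, 0 < d & forall y, enorm (y - z) < d -> `|q y - q z| < e.

Lemma min_attained l u C (q : 'cV[R]_n -> R) : C `<=` box l u -> vclosed C ->
  (forall z, vcontinuous_at q z) -> C !=set0 ->
  exists2 z, C z & forall y, C y -> q z <= q y.
Proof.
move=> Clu Ccl qc [z0 Cz0].
have [M M0 MP] : exists2 M : R, 0 < M & forall y, box l u y -> - M <= q y.
  apply: (locally_bounded_box (Q := fun y M => - M <= q y)).
    by move=> x M M' MM'; apply: le_trans; rewrite lerN2.
  move=> z _; have [d d0 dP] := qc z 1 ltr01; exists d, (1 - q z); split=> // y _.
  by move=> /dP; rewrite ltr_norml => /andP[H _]; lra.
pose S := q @` C.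
have hS : has_inf S.
  split; first by exists (q z0), z0.
  by exists (- M) => _ [y Cy <-]; apply: MP; exact: Clu.
have ex k : exists y, C y /\ q y < inf S + k.+1%:R^-1.
  have k0 : (0 : R) < k.+1%:R^-1 by rewrite invr_gt0.
  by have [_ [y Cy <-] yk] := inf_adherent k0 hS; exists y.
have [xs xsP] := choice ex.
have [z zacc] := bounded_accum_points (fun k => Clu _ (xsP k).1).
have Cz : C z.
  by apply: Ccl => e /zacc/(_ 0%N)[k [_ ?]]; exists (xs k) => //; exact: (xsP k).1.
exists z => // y Cy; apply: (@le_trans _ _ (inf S)); last first.
  by apply: ge_inf; [exact: hS.2|exists y].
apply/ler_addgt0Pr => e e0.
have [d d0 dP] := qc z (e / 2) ltac:(by rewrite divr_gt0).
have [k [kM kz]] := zacc d d0 (Num.bound `|2 / e|).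
have [_] := xsP k; set a := k.+1%:R^-1 => H2.
have H3 : a < e / 2.
  rewrite -[ltRHS]invrK ltf_pV2 ?posrE ?invr_gt0 ?divr_gt0// invf_div.
  rewrite (le_lt_trans (ler_norm _))// (lt_le_trans (archi_boundP _))//.
  by rewrite ler_nat (leq_trans kM).
by move: (dP _ kz); rewrite ltr_norml => /andP[+ _]; move: a H2 H3 => a; lra.
Qed.

(** The minimum of the radii works; starting it at 1 keeps it positive when [T] is empty. *)
Lemma fin_radius (T : finType) (P : T -> R -> Prop) :
  (forall i d d', d' <= d -> P i d -> P i d') ->
  (forall i, exists2 d : R, 0 < d & P i d) ->
  exists2 d : R, 0 < d & forall i, P i d.
Proof.
move=> Pmon exd.
have ex i : exists d : R, 0 < d /\ P i d by have [d] := exd i; exists d.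
have [dl dlP] := choice ex.
exists (\big[Num.min/1]_i dl i) => [|i].
  by elim/big_ind: _ => // [a b a0 b0|i _]; [rewrite lt_min a0|exact: (dlP i).1].
by apply: Pmon (dlP i).2; exact: bigmin_le_cond.
Qed.

End Compactness.

(** * Second-order calculus *)

Section Calculus.
Context {R : realType}.

(** The bridge from the epsilon-delta expansions in [has_grad] and [has_jac], restricted to lines,
    to derivatives to which the mean value theorem applies. *)
Lemma is_derive_littleo (phi : R -> R) (t l : R) :
  (forall e : R, 0 < e -> exists2 d : R, 0 < d & forall h, `|h| < d ->
     `|phi (t + h) - phi t - h * l| <= e * `|h|) ->
  is_derive t 1 phi l.
Proof.
move=> phil.
have cv : h^-1 *: ((phi \o shift t) (h *: (1 : R)) - phi t) @[h --> 0^'] --> l.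
  apply/cvgrPdist_le => e e0; have [d d0 dP] := phil e e0.
  near=> h; have h0 : h != 0 by near: h; exact: nbhs_dnbhs_neq.
  have hd : `|h| < d by near: h; exact: dnbhs0_lt.
  have {hd} := dP h hd; rewrite /= /shift [h *: 1]mulr1 (addrC h) => hl.
  rewrite distrC -(ler_pM2r (x := `|h|)) ?normr_gt0// -normrM mulrBl [l * h]mulrC.
by rewrite [h^-1 *: _]mulrC -mulrA mulVf// mulr1.
by apply: DeriveDef; [exact: cvgP cv|exact: cvg_lim cv].
Unshelve. all: by end_near. Qed.

Lemma is_derive_unique (phi : R -> R) (t a b : R) :
  is_derive t 1 phi a -> is_derive t 1 phi b -> a = b.
Proof. by move=> ha hb; rewrite -(derive_val (is_derive := ha)) (derive_val (is_derive := hb)). Qed.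

Lemma is_derive_affine (a c t : R) : is_derive t 1 (fun s => a + s * c) c.
Proof.
apply: is_derive_littleo => e e0; exists 1 => // h _.
rewrite (_ : _ - _ - _ = 0); last by ring.
by rewrite normr0 mulr_ge0// ltW.
Qed.

Lemma MVT0 (phi dphi : R -> R) (b : R) : 0 < b ->
  (forall t : R, is_derive t 1 phi (dphi t)) ->
  exists2 c, 0 < c < b & phi b - phi 0 = dphi c * b.
Proof.
move=> b0 dP; have cphi : {within `[0, b], continuous phi}.
  by apply: derivable_within_continuous => t _; exact: (@ex_derive _ _ _ _ _ _ _ (dP t)).
have [c] := MVT b0 (fun t _ => dP t) cphi.
by rewrite in_itv/= subr0 => c0; exists c.
Qed.

(** The mean value theorem twice: [psi] subtracts the quadratic, and its derivative at [c] equals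
    [(ddphi c' - M) * c <= 0]. Only an upper bound of the second derivative on the open interval
    enters. *)
Lemma taylor2_le (phi dphi ddphi : R -> R) (M : R) :
  (forall t : R, is_derive t 1 phi (dphi t)) ->
  (forall t : R, is_derive t 1 dphi (ddphi t)) ->
  (forall t : R, 0 < t < 1 -> ddphi t <= M) ->
  phi 1 <= phi 0 + dphi 0 + M / 2.
Proof.
move=> d1 d2 dM.
pose psi t := phi t - (dphi 0 * t + M / 2 * t ^+ 2).
pose dpsi t := dphi t - (dphi 0 + M * t).
have dpsiP (t : R) : is_derive t 1 psi (dpsi t).
  apply: is_deriveB; apply: is_derive_littleo => e e0.
  exists (e / (`|M| + 1)) => [|h he]; first by rewrite divr_gt0// ltr_wpDl.
  have -> : dphi 0 * (t + h) + M / 2 * (t + h) ^+ 2 -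
    (dphi 0 * t + M / 2 * t ^+ 2) - h * (dphi 0 + M * t) = (M / 2 * h) * h by field.
  rewrite normrM ler_wpM2r// normrM; move: he; rewrite ltr_pdivlMr ?ltr_wpDl// => he.
  have M2 : `|M / 2| <= `|M| by rewrite normrM ler_piMr// ger0_norm//; lra.
  by have := ler_wpM2r (normr_ge0 h) M2; have := normr_ge0 h; lra.
have [c /andP[c0 c1]] := MVT0 ltr01 dpsiP.
have [c' /andP[c'0 c'c] dc] := MVT0 c0 d2.
have := ler_wpM2r (ltW c0) (dM c' ltac:(lra)).
by rewrite -dc /psi /dpsi expr0n expr1n/=; lra.
Qed.

End Calculus.

(** * Taylor bounds in several variables and symmetry of the Hessian *)

Section Multivariate.
Context {R : realType} {n : nat}.
Variables (f : 'cV[R]_n -> R) (g : 'cV[R]_n -> 'cV[R]_n) (H : 'cV[R]_n -> 'M[R]_n).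
Implicit Types (x v w : 'cV[R]_n).

Lemma line_derive x v (t : R) : has_grad f g ->
  is_derive t 1 (fun s => f (x + s *: v)) (dotp (g (x + t *: v)) v).
Proof.
move=> fg; apply: is_derive_littleo => e e0.
have v1 : 0 < enorm v + 1 by rewrite ltr_wpDl ?enorm_ge0.
have [d [d0 dP]] := fg (x + t *: v) (e / (enorm v + 1)) ltac:(by rewrite divr_gt0).
exists (d / (enorm v + 1)) => [|h hd]; first by rewrite divr_gt0.
have hv : `|h| * enorm v <= `|h| * (enorm v + 1) by rewrite ler_wpM2l// lerDl.
have := dP (h *: v); rewrite enormZ (le_lt_trans hv) -?ltr_pdivlMr// => /(_ isT).
rewrite dotpZr scalerDl addrA => /le_trans; apply.
by rewrite -mulrA ler_pM2l// ler_pdivrMl// [leRHS]mulrC.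
Qed.

Lemma line_derive2 x v w (t : R) : has_jac g H ->
  is_derive t 1 (fun s => dotp (g (x + s *: v)) w) (dotp (H (x + t *: v) *m v) w).
Proof.
move=> gH; apply: is_derive_littleo => e e0.
have v1 : 0 < enorm v + 1 by rewrite ltr_wpDl ?enorm_ge0.
have w1 : 0 < enorm w + 1 by rewrite ltr_wpDl ?enorm_ge0.
have [d [d0 dP]] := gH (x + t *: v) (e / ((enorm v + 1) * (enorm w + 1)))
  ltac:(by rewrite divr_gt0// mulr_gt0).
exists (d / (enorm v + 1)) => [|h hd]; first by rewrite divr_gt0.
have hv : `|h| * enorm v <= `|h| * (enorm v + 1) by rewrite ler_wpM2l// lerDl.
have := dP (h *: v); rewrite enormZ (le_lt_trans hv) -?ltr_pdivlMr// => /(_ isT).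
rewrite -scalemxAr scalerDl addrA -dotpZl -!dotpBl.
set z := _ - _ - _ => zle; apply: (le_trans (dotp_abs _ _)).
apply: (@le_trans _ _ (enorm z * (enorm w + 1))).
  by rewrite ler_wpM2l ?enorm_ge0// lerDl.
rewrite -ler_pdivlMr// (le_trans zle)// ler_pdivlMr//.
rewrite (_ : _ * _ * _ = e * `|h| * (enorm v / (enorm v + 1))); last first.
  by field; rewrite !gt_eqF.
rewrite ler_piMr ?mulr_ge0 ?(ltW e0)//.
by rewrite ler_pdivrMr// mul1r lerDl.
Qed.

Lemma grad_continuous_at x (e : R) : has_jac g H -> 0 < e ->
  exists2 d : R, 0 < d & forall y, enorm (y - x) < d -> enorm (g y - g x) < e.
Proof.
move=> gH e0; have [d [d0 dP]] := gH x 1 ltr01.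
have M1 : 0 < fnorm (H x) + 1 by rewrite ltr_wpDl ?fnorm_ge0.
exists (Num.min d (e / (fnorm (H x) + 1))) => [|y].
  by rewrite lt_min d0 divr_gt0.
rewrite lt_min => /andP[/dP]; rewrite [x + _]addrC subrK mul1r => yx.
rewrite ltr_pdivlMr// => ye; have := enorm_mulmx (H x) (y - x).
have := enormD (g y - g x - H x *m (y - x)) (H x *m (y - x)).
by rewrite subrK; lra.
Qed.

Lemma fun_continuous x : has_grad f g -> vcontinuous_at f x.
Proof.
move=> fg e e0; have [d [d0 dP]] := fg x 1 ltr01.
have M1 : 0 < enorm (g x) + 1 by rewrite ltr_wpDl ?enorm_ge0.
exists (Num.min d (e / (enorm (g x) + 1))) => [|y].
  by rewrite lt_min d0 divr_gt0.
rewrite lt_min => /andP[/dP]; rewrite [x + _]addrC subrK mul1r => yx.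
rewrite ltr_pdivlMr// => ye; have := dotp_abs (g x) (y - x).
have := ler_normD (f y - f x - dotp (g x) (y - x)) (dotp (g x) (y - x)).
by rewrite subrK; lra.
Qed.

Lemma second_order_le x v (M : R) : C2_with f g H ->
  (forall t : R, 0 < t < 1 -> dotp (H (x + t *: v) *m v) v <= M) ->
  f (x + v) <= f x + dotp (g x) v + M / 2.
Proof.
move=> [fg [gH _]] HM.
have := taylor2_le (line_derive x v ^~ fg) (line_derive2 x v v ^~ gH) HM.
by rewrite scale1r scale0r addr0.
Qed.

(** The mean value theorem in direction [v] for a difference of two copies of [f], then in direction
    [w] for the gradient. The left side is symmetric in [v] and [w], which is what [hessian_sym]
    exploits. *)
Lemma second_difference x v w s : C2_with f g H -> 0 < s ->
  exists c1 c2, [/\ 0 < c1 < s, 0 < c2 < s &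
    f (x + s *: w + s *: v) - f (x + s *: v) - f (x + s *: w) + f x =
    dotp (H (x + c1 *: v + c2 *: w) *m w) v * s * s].
Proof.
move=> [fg [gH _]] s0.
have dpsi (t : R) : is_derive t 1 (fun r : R => f (x + s *: w + r *: v) - f (x + r *: v))
    (dotp (g (x + s *: w + t *: v)) v - dotp (g (x + t *: v)) v).
  by apply: is_deriveB; exact: line_derive.
have [c1 c1s E1] := MVT0 s0 dpsi.
have [c2 c2s E2] := MVT0 s0 (line_derive2 (x + c1 *: v) w v ^~ gH).
exists c1, c2; split => //; rewrite -E2 scale0r addr0.
move: E1; rewrite !scale0r !addr0 (addrAC x (s *: w) (c1 *: v)) => <-; ring.
Qed.

(** Schwarz's theorem: the same second difference equals two Hessian values with [v] and [w]
    exchanged, both taken close to [x]. Symmetry is what makes Rayleigh quotients and the gradient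
    of the Newton model available. *)
Lemma hessian_sym x : C2_with f g H -> (H x)^T = H x.
Proof.
move=> C2; suff sym v w : dotp (H x *m w) v = dotp (H x *m v) w.
  apply/matrixP => i j; rewrite mxE.
  have dE k l : dotp (H x *m delta_mx k 0) (delta_mx l 0) = H x l k.
    rewrite -colE /dotp (bigD1 l)//= big1 ?addr0 => [|m /negPf ml].
      by rewrite !mxE !eqxx mulr1.
    by rewrite !mxE ml mulr0.
  by rewrite -!dE.
have [_ [_ Hc]] := C2.
apply/eqP; rewrite -subr_eq0 -normr_le0; apply/ler_addgt0Pr => e e0; rewrite add0r.
pose m := (enorm v * enorm w + 1) * 2.
have m0 : 0 < m by rewrite mulr_gt0// ltr_wpDl// mulr_ge0 ?enorm_ge0.
have [d [d0 dP]] := Hc x (e / m) ltac:(by rewrite divr_gt0).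
pose D := enorm v + enorm w + 1.
have D0 : 0 < D by rewrite ltr_wpDl// addr_ge0 ?enorm_ge0.
(* The factor [D] keeps both displaced points within [d] of [x], and [m] makes each of the two
   comparison errors at most [e / 2]. *)
pose s := d / D; have s0 : 0 < s by rewrite divr_gt0.
have close a b c1 c2 : enorm a + enorm b + 1 = D -> enorm b * enorm a + 1 = m / 2 ->
    0 < c1 < s -> 0 < c2 < s ->
    `|dotp (H (x + c1 *: a + c2 *: b) *m b) a - dotp (H x *m b) a| <= e / 2.
  move=> abD abm /andP[c10 c1s] /andP[c20 c2s].
  have : enorm (x + c1 *: a + c2 *: b - x) < d.
    rewrite -(addrA x) [x + _]addrC addrK (le_lt_trans (enormD _ _))// !enormZ.
    rewrite !gtr0_norm//.
    have := ler_wpM2r (enorm_ge0 a) (ltW c1s); have := ler_wpM2r (enorm_ge0 b) (ltW c2s).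
    have : s * D = d by rewrite divfK// gt_eqF.
    by rewrite -abD; lra.
  move=> /dP/ltW Hd; rewrite -dotpBl -mulmxBl (le_trans (dotp_abs _ _))//.
  rewrite (le_trans (ler_wpM2r (enorm_ge0 _) (enorm_mulmx _ _)))// -mulrA.
  have ab0 : 0 <= enorm b * enorm a by rewrite mulr_ge0 ?enorm_ge0.
  rewrite (le_trans (ler_wpM2r ab0 Hd))// -mulrA ler_pM2l// ler_pdivrMl//; lra.
have [c1 [c2 [c1s c2s E1]]] := second_difference x v w C2 s0.
have [c3 [c4 [c3s c4s E2]]] := second_difference x w v C2 s0.
have L1 := close v w c1 c2 erefl ltac:(rewrite /m; lra) c1s c2s.
have L2 := close w v c3 c4 ltac:(rewrite /D; lra) ltac:(rewrite /m; lra) c3s c4s.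
have E : dotp (H (x + c1 *: v + c2 *: w) *m w) v =
         dotp (H (x + c3 *: w + c4 *: v) *m v) w.
  have ss : s != 0 by rewrite gt_eqF.
  apply: (mulIf ss); apply: (mulIf ss); move: E1 E2 => /= <- <-.
  by rewrite (addrAC x (s *: v)); ring.
rewrite E in L1; rewrite distrC in L1.
have := ler_distD (dotp (H (x + c3 *: w + c4 *: v) *m v) w)
  (dotp (H x *m w) v) (dotp (H x *m v) w); lra.
Qed.

End Multivariate.

(** * Quadratic forms and regularized Hessians *)

Section Quadratic.
Context {R : realType}.

Lemma enorm_lipschitz {n} (y z : 'cV[R]_n) : `|enorm y - enorm z| <= enorm (y - z).
Proof.
rewrite ler_norml; have := enormD (y - z) z; have := enormD (z - y) y.
by rewrite !subrK (enormB z y) => *; apply/andP; split; lra.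
Qed.

Lemma has_grad_quad {n} (M : 'M[R]_n) :
  has_grad (fun z => dotp (M *m z) z) (fun z => (M + M^T) *m z).
Proof.
move=> x e e0; have M1 : 0 < fnorm M + 1 by rewrite ltr_wpDl ?fnorm_ge0.
exists (e / (fnorm M + 1)); split=> [|h]; first by rewrite divr_gt0.
rewrite ltr_pdivlMr// => he.
have -> : dotp (M *m (x + h)) (x + h) - dotp (M *m x) x - dotp ((M + M^T) *m x) h =
    dotp (M *m h) h.
  rewrite mulmxDr mulmxDl !dotp_lin (dotpC (M^T *m x)) -dotp_adj; ring.
rewrite (le_trans (dotp_abs _ _))// ler_wpM2r ?enorm_ge0//.
by have := enorm_mulmx M h; have := enorm_ge0 h; lra.
Qed.

Lemma quad_continuous {n} (M : 'M[R]_n) z : vcontinuous_at (fun z => dotp (M *m z) z) z.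
Proof. exact: fun_continuous (has_grad_quad M). Qed.

(** A quadratic that is minimal at its zero [t = 0] has no linear part. If [c < 0], the values
    [(1 + 2b)/c] and [(1 - 2b)/c] at [1/c] and [-1/c] cannot both be nonnegative. *)
Lemma linear_part_eq0 (b c : R) : (forall t, 0 <= 2 * t * b + t ^+ 2 * c) -> b = 0.
Proof.
move=> H; have c0 : 0 <= c.
  rewrite leNgt; apply/negP => c0; have := H (- (2 * b + 1) / c).
  have -> : 2 * (- (2 * b + 1) / c) * b + (- (2 * b + 1) / c) ^+ 2 * c = (2 * b + 1) / c.
    by field; rewrite lt_eqF.
  have := H ((2 * b + 1) / c).
  have -> : 2 * ((2 * b + 1) / c) * b + ((2 * b + 1) / c) ^+ 2 * c =
    (2 * b + 1) * (4 * b + 1) / c by field; rewrite lt_eqF.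
  have := H (1 / c); have := H (- 1 / c).
  have -> : 2 * (- 1 / c) * b + (- 1 / c) ^+ 2 * c = (1 - 2 * b) / c by field; rewrite lt_eqF.
  have -> : 2 * (1 / c) * b + (1 / c) ^+ 2 * c = (1 + 2 * b) / c by field; rewrite lt_eqF.
  have ci : c^-1 < 0 by rewrite invr_lt0.
  by rewrite !nmulr_lge0//; lra.
have c1 : 0 < c + 1 by rewrite ltr_wpDl.
(* The minimizer [- b / c] would require [c] nonzero; the shifted point already gives a negative
   value unless [b = 0]. *)
have := H (- b / (c + 1)).
have -> : 2 * (- b / (c + 1)) * b + (- b / (c + 1)) ^+ 2 * c =
    - (b ^+ 2 * (c + 2) / (c + 1) ^+ 2) by field; rewrite gt_eqF.
rewrite oppr_ge0 pmulr_lle0 ?invr_gt0 ?exprn_gt0// pmulr_lle0 ?ltr_wpDl//.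
by move=> b2; apply/eqP; rewrite -sqrf_eq0 eq_le b2 sqr_ge0.
Qed.

(* The minimum of the Rayleigh quotient over the unit sphere is an eigenvalue. *)
Lemma lmin_le_quad {n} (M : 'M[R]_n) a v : M^T = M -> is_lmin M a ->
  a * enorm v ^+ 2 <= dotp (M *m v) v.
Proof.
move=> Msym [_ amin]; have [->|/eqP/enorm_gt0 v0] := eqVneq v 0.
  by rewrite enorm0 expr0n mulr0 dotp0r.
pose S : set 'cV[R]_n := [set w | enorm w = 1].
have Sbox : S `<=` box (const_mx (-1)) (const_mx 1).
  move=> w w1 i; rewrite !mxE -ler_norml.
  by rewrite (le_trans (coord_le_enorm _ _))// w1.
have Scl : vclosed S.
  move=> z zS; apply/eqP; rewrite /S/= -subr_eq0 -normr_le0.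
  apply/ler_addgt0Pr => e /zS[y y1 yz]; rewrite add0r -y1 -[X in `|X|]opprB normrN.
  by rewrite (le_trans (enorm_lipschitz _ _))// ltW.
have [|w w1 wmin] := min_attained Sbox Scl (quad_continuous M).
  exists ((enorm v)^-1 *: v); rewrite /S/= enormZ gtr0_norm ?invr_gt0//.
  by rewrite mulVf// gt_eqF.
set m := dotp (M *m w) w in wmin.
have mle z : m * enorm z ^+ 2 <= dotp (M *m z) z.
  have [->|/eqP/enorm_gt0 z0] := eqVneq z 0.
    by rewrite enorm0 expr0n mulr0 dotp0r.
  have := wmin ((enorm z)^-1 *: z).
  rewrite /S/= enormZ gtr0_norm ?invr_gt0// mulVf ?gt_eqF// => /(_ erefl).
  rewrite -scalemxAr dotpZl dotpZr mulrA -invfM -ler_pdivrMl ?invr_gt0 ?mulr_gt0//.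
  by rewrite invrK mulrC -expr2.
(* The form of [M - m I] is nonnegative and vanishes at [w], so its linear part at [w] is zero in
   every direction. *)
have wd z : dotp (M *m w - m *: w) z = 0.
  apply: (@linear_part_eq0 _ (dotp (M *m z) z - m * enorm z ^+ 2)) => t.
  have := mle (w + t *: z).
  have ww : dotp w w = 1 by rewrite -enorm_sqr w1 expr1n.
  rewrite !enorm_sqr mulmxDr -scalemxAr !dotp_lin -/m ww.
  rewrite (dotpC z w) (_ : dotp (M *m z) w = dotp (M *m w) z); last first.
    by rewrite dotp_adj Msym dotpC.
  by rewrite expr2; lra.
have Mw : M *m w = m *: w by apply/eqP; rewrite -subr_eq0; apply/eqP/dotp_eq0/wd.
apply: (le_trans _ (mle v)); rewrite ler_wpM2r ?exprn_ge0 ?enorm_ge0//.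
(* [eigenvalue] speaks of row vectors acting from the left; symmetry of [M] turns the column
   eigenvector into one. *)
apply: amin; apply/eigenvalueP; exists w^T.
  by rewrite -[in LHS]Msym -trmx_mul Mw linearZ.
by apply: contra_eq_neq w1 => /eqP; rewrite trmx_eq0 => /eqP ->; rewrite enorm0 eq_sym oner_neq0.
Qed.

Lemma eigenvalue_abs_le {n} (M : 'M[R]_n) a (C : R) : M^T = M -> eigenvalue M a ->
  (forall v, enorm (M *m v) <= C * enorm v) -> `|a| <= C.
Proof.
move=> Msym /eigenvalueP[w Mw w0] MC.
have w1 : 0 < enorm w^T.
  by apply: enorm_gt0; apply/eqP; rewrite trmx_eq0.
have := MC w^T; rewrite -[in X in X -> _]Msym -trmx_mul Mw linearZ enormZ.
by rewrite ler_pM2r.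
Qed.

Lemma diag_mulE {q} (d : 'rV[R]_q) (w : 'cV[R]_q) i :
  (diag_mx d *m w) i 0 = d 0 i * w i 0.
Proof. by rewrite mul_diag_mx mxE. Qed.

Lemma lmin_diag {q} (d : 'rV[R]_q) a : is_lmin (diag_mx d) a ->
  (exists i, a = d 0 i) /\ forall i, a <= d 0 i.
Proof.
move=> [/eigenvalueP[w dw w0] amin]; split.
  have /rV0Pn[i wi] := w0; exists i; apply: (mulIf wi).
  by move/rowP: dw => /(_ i); rewrite mul_mx_diag !mxE mulrC.
move=> i; apply: amin; apply/eigenvalueP; exists (delta_mx 0 i).
  apply/rowP => j; rewrite mul_mx_diag !mxE eqxx/=.
  by case: eqVneq => [->|]; rewrite ?mulr1 ?mul1r ?mulr0 ?mul0r.
by apply/eqP => /rowP/(_ i)/eqP; rewrite !mxE !eqxx oner_eq0.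
Qed.

Lemma enorm_diag_le {q} (d : 'rV[R]_q) (w : 'cV[R]_q) (K : R) : 0 <= K ->
  (forall i, `|d 0 i| <= K) -> enorm (diag_mx d *m w) <= K * enorm w.
Proof.
move=> K0 dK; apply: ler_enorm_sqr; first by rewrite mulr_ge0 ?enorm_ge0.
rewrite exprMn enorm_sqr /dotp mulr_sumr; apply: ler_sum => i _.
rewrite diag_mulE -!expr2 exprMn ler_wpM2r ?sqr_ge0// -real_normK ?num_real//.
by rewrite ler_pXn2r ?nnegrE.
Qed.

End Quadratic.

(** * Uniform Hessian bounds and the structure of separable objectives *)

Section RegularizedHessian.
Context {R : realType} {n : nat}.
Variables (f : 'cV[R]_n -> R) (g : 'cV[R]_n -> 'cV[R]_n) (H : 'cV[R]_n -> 'M[R]_n).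
Hypothesis C2 : C2_with f g H.
Variables (l u : 'cV[R]_n).

Lemma hessian_bounded : exists2 M : R, 0 < M &
  forall x, box l u x -> forall v, enorm (H x *m v) <= M * enorm v.
Proof.
apply: (locally_bounded_box (Q := fun x M => forall v, enorm (H x *m v) <= M * enorm v)).
  move=> x M M' MM' HM v; apply: le_trans (HM v) _.
  by rewrite ler_wpM2r ?enorm_ge0.
move=> z _; have [_ [_ Hc]] := C2; have [d [d0 dP]] := Hc z 1 ltr01.
exists d, (fnorm (H z) + 1); split => // y _ /dP/ltW yz v.
have := ler_wpM2r (enorm_ge0 v) yz; rewrite mul1r.
have := enorm_mulmx (H y - H z) v; have := enorm_mulmx (H z) v.
by have := enormD ((H y - H z) *m v) (H z *m v); rewrite -mulmxDl subrK; lra.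
Qed.

Context {q : nat}.
Variables (A : 'M[R]_(q, n)) (b : 'cV[R]_q) (hs hs1 hs2 : 'I_q -> R -> R).
Hypothesis sep : sep_composite f A b hs hs1 hs2.

(** Both sides are the second derivative of [f] along the line through [x] in direction [v], so they
    agree by uniqueness of derivatives; no matrix chain rule is involved. *)
Lemma sep_hessian_quad x v : dotp (H x *m v) v =
  \sum_i hs2 i ((A *m x - b) i 0) * (A *m v) i 0 ^+ 2.
Proof.
have [fE [h1 [h2 _]]] := sep; have [fg [gH _]] := C2.
pose c i := (A *m v) i 0.
pose arg i (s : R) := (A *m x - b) i 0 + s * c i.
have argE (s : R) i : (A *m (x + s *: v) - b) i 0 = arg i s.
  by rewrite mulmxDr -scalemxAr /arg /c !mxE; ring.
have darg i (t : R) : is_derive t 1 (arg i) (c i) by exact: is_derive_affine.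
have d1 (t : R) : dotp (g (x + t *: v)) v = \sum_i hs1 i (arg i t) * c i.
  apply: is_derive_unique (line_derive x v t fg) _.
  rewrite (_ : (fun s => _) = \sum_i (hs i \o arg i)); last first.
    apply/funext => s; rewrite fE fct_sumE; apply: eq_bigr => i _ /=.
    by rewrite argE.
  by apply: is_derive_sum => i; exact: is_derive1_comp.
have := line_derive2 x v v 0 gH; rewrite scale0r addr0 => d2.
apply: is_derive_unique d2 _.
rewrite (_ : (fun s => _) = \sum_i ((fun s => hs1 i s * c i) \o arg i)); last first.
  by apply/funext => s; rewrite d1 fct_sumE.
apply: is_derive_sum => i; rewrite expr2 mulrA.
have -> : (A *m x - b) i 0 = arg i 0 by rewrite /arg mul0r addr0.
apply: is_derive1_comp.
rewrite (_ : (fun s => _) = (c i) \*: hs1 i); last first.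
  by apply/funext => s; rewrite mulrC.
by rewrite [_ * c i]mulrC; exact: is_deriveZ.
Qed.

Lemma sep_hess_bounded : exists2 K : R, 0 < K &
  forall x, box l u x -> forall i, `|hs2 i ((A *m x - b) i 0)| <= K.
Proof.
apply: (locally_bounded_box (Q := fun x K => forall i, `|hs2 i ((A *m x - b) i 0)| <= K)).
  by move=> x M M' MM' HM i; exact: le_trans (HM i) MM'.
have [_ [_ [_ hc]]] := sep => z _.
pose t i := (A *m z - b) i 0.
have [|i|d d0 dP] := @fin_radius R 'I_q
    (fun i d => forall y, enorm (y - z) < d -> `|hs2 i ((A *m y - b) i 0)| <= `|hs2 i (t i)| + 1).
- by move=> i d d' dd' dP y yz; apply: dP; exact: lt_le_trans dd'.
- have A1 : 0 < fnorm A + 1 by rewrite ltr_wpDl ?fnorm_ge0.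
  have /cvgrPdist_le/(_ 1 ltr01)/nbhs_ballP[d /= d0 dP] := hc i (t i).
  exists (d / (fnorm A + 1)) => [|y]; first by rewrite divr_gt0.
  rewrite ltr_pdivlMr// => yz.
  have /dP/= : ball (t i) d ((A *m y - b) i 0).
    rewrite /ball/= distrC.
    have -> : (A *m y - b) i 0 - t i = (A *m (y - z)) i 0.
      by rewrite /t mulmxBr !mxE; ring.
    apply: (le_lt_trans (coord_le_enorm _ _)).
    apply: (le_lt_trans (enorm_mulmx _ _)); have := enorm_ge0 (y - z); lra.
  have := ler_normD (hs2 i ((A *m y - b) i 0) - hs2 i (t i)) (hs2 i (t i)).
  by rewrite subrK distrC; lra.
exists d, (\sum_i (`|hs2 i (t i)| + 1)); split=> // y _ yz i.
by rewrite (le_trans (dP i y yz))// (bigD1 i)//= lerDl sumr_ge0.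
Qed.

End RegularizedHessian.

Section NewtonMatrix.
Context {R : realType} {n : nat}.
Variables (f : 'cV[R]_n -> R) (g : 'cV[R]_n -> 'cV[R]_n) (H : 'cV[R]_n -> 'M[R]_n).
Hypothesis C2 : C2_with f g H.
Variables (l u : 'cV[R]_n) (b1 b2 sigma : R).
Hypotheses (b1_gt0 : 0 < b1) (b2_ge1 : 1 <= b2).
Variables (x xbar : nat -> 'cV[R]_n) (mubar : nat -> R) (G : nat -> 'M[R]_n).

Let e := ek b1 sigma x xbar mubar.

(** The common interface of the three regularizations. The bound on [G] yields coercivity of the
    Newton model; the bound on [G - H] makes the model dominate the true second-order term, which
    the acceptance of unit steps relies on. *)
Definition newton_matrix_spec (M : R) := forall k, box l u (x k) ->
  (G k)^T = G k /\ forall v,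
  [/\ e k * enorm v ^+ 2 <= dotp (G k *m v) v,
      e k * enorm v ^+ 2 <= dotp ((G k - H (x k)) *m v) v &
      enorm (G k *m v) <= (M + e k) * enorm v].

Let e_ge0 k : 0 <= e k.
Proof. by rewrite mulr_ge0 ?(ltW b1_gt0)// powR_ge0. Qed.

Let max_bound (a K : R) : 0 < K -> `|a| <= K -> 0 <= b2 * Num.max (- a) 0 <= b2 * K.
Proof.
have b20 : 0 <= b2 by exact: le_trans ler01 b2_ge1.
move=> K0; rewrite ler_norml => /andP[aK _].
rewrite mulr_ge0 ?le_max ?lexx ?orbT//= ler_wpM2l// ge_max (ltW K0) andbT.
by rewrite lerNl.
Qed.

(** For negative [a] the sum is [(b2 - 1) * - a]: with [b2 >= 1] the shift at least compensates the
    negative curvature. *)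
Let shift_ge0 (a : R) : 0 <= a + b2 * Num.max (- a) 0.
Proof.
have [a0|a0] := leP 0 a; first by rewrite max_r ?oppr_le0// mulr0 addr0.
have a0' : 0 <= - a by rewrite oppr_ge0 ltW.
have -> : a + b2 * Num.max (- a) 0 = (b2 - 1) * - a by rewrite (max_l a0'); ring.
by rewrite mulr_ge0// subr_ge0.
Qed.

Lemma Gchoice1_spec : Gchoice1 H b1 b2 sigma x xbar mubar G ->
  exists2 M : R, 0 < M & newton_matrix_spec M.
Proof.
move=> GE; have [M M0 HM] := hessian_bounded C2 l u.
exists (M + b2 * M) => [|k xk]; first by rewrite addr_gt0// mulr_gt0// (lt_le_trans ltr01).
have [a [alm ->]] := GE k; rewrite -/(e k).
have Hsym := hessian_sym (x k) C2.
have aM := eigenvalue_abs_le Hsym alm.1 (HM _ xk).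
have /andP[m0 mM] := max_bound M0 aM.
set m := b2 * _ in m0 mM *; split=> [|v].
  by rewrite linearD/= Hsym tr_scalar_mx.
have ql := lmin_le_quad v Hsym alm; have ek0 := e_ge0 k; have v0 := enorm_ge0 v.
have v2 : 0 <= enorm v ^+ 2 by rewrite exprn_ge0.
rewrite mulmxDl mul_scalar_mx; split.
- rewrite !dotp_lin -enorm_sqr.
  by have := mulr_ge0 (shift_ge0 a) v2; rewrite -/m; lra.
- rewrite addrAC subrr add0r mul_scalar_mx !dotp_lin -enorm_sqr.
  by have := mulr_ge0 m0 v2; lra.
- rewrite (le_trans (enormD _ _))// enormZ ger0_norm ?addr_ge0//.
  by have := HM _ xk v; have := ler_wpM2r v0 mM; lra.
Qed.

Section Separable.
Context {q : nat}.
Variables (A : 'M[R]_(q, n)) (b : 'cV[R]_q) (hs hs1 hs2 : 'I_q -> R -> R).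
Hypothesis sep : sep_composite f A b hs hs1 hs2.

Lemma Gchoice2_spec : Gchoice2 H A b hs2 b1 b2 sigma x xbar mubar G ->
  exists2 M : R, 0 < M & newton_matrix_spec M.
Proof.
move=> GE; have [M M0 HM] := hessian_bounded C2 l u.
have [K K0 hK] := sep_hess_bounded l u sep.
exists (M + b2 * K * fnorm (A^T *m A)) => [|k xk].
  by rewrite ltr_wpDr// mulr_ge0 ?fnorm_ge0// mulr_ge0 ?(ltW K0)// (le_trans ler01).
have [a [/lmin_diag[[i0 ai0] alm] ->]] := GE k; rewrite -/(e k).
have aM : `|a| <= K by rewrite ai0 mxE; exact: hK.
have /andP[m0 mM] := max_bound K0 aM.
have Hsym := hessian_sym (x k) C2.
set m := b2 * _ in m0 mM *; split=> [|v].
  by rewrite !linearD/= Hsym tr_scalar_mx linearZ/= trmx_mul trmxK.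
have ek0 := e_ge0 k; have v0 := enorm_ge0 v.
have Av2 : 0 <= enorm (A *m v) ^+ 2 by rewrite exprn_ge0 ?enorm_ge0.
have AA : dotp (A^T *m A *m v) v = enorm (A *m v) ^+ 2.
  by rewrite -mulmxA dotp_adj trmxK enorm_sqr.
(* The shift multiplies [A^T *m A], so the curvature of [f] has to be bounded below in terms of
   [A *m v] rather than [v]. *)
have ql : a * enorm (A *m v) ^+ 2 <= dotp (H (x k) *m v) v.
  rewrite (sep_hessian_quad C2 sep) enorm_sqr /dotp mulr_sumr.
  apply: ler_sum => i _; rewrite -expr2 ler_wpM2r ?sqr_ge0//.
  by have := alm i; rewrite mxE.
rewrite !mulmxDl mul_scalar_mx -scalemxAl; split.
- rewrite !dotp_lin AA -enorm_sqr.
  by have := mulr_ge0 (shift_ge0 a) Av2; rewrite -/m; lra.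
- rewrite mulNmx !dotp_lin AA -enorm_sqr.
  by have := mulr_ge0 m0 Av2; lra.
- rewrite (le_trans (enormD _ _))// !enormZ (ger0_norm ek0).
  have := enormD (H (x k) *m v) (m *: (A^T *m A *m v)); rewrite enormZ (ger0_norm m0).
  have := HM _ xk v; have F0 := fnorm_ge0 (A^T *m A).
  have := ler_wpM2l m0 (enorm_mulmx (A^T *m A) v).
  by have := ler_wpM2r (mulr_ge0 F0 v0) mM; lra.
Qed.

Lemma Gchoice3_spec : Gchoice3 A b hs2 b1 sigma x xbar mubar G ->
  exists2 M : R, 0 < M & newton_matrix_spec M.
Proof.
move=> GE; have [K K0 hK] := sep_hess_bounded l u sep.
pose M := fnorm A^T * (K * fnorm A); exists (M + 1) => [|k xk].
  by rewrite ltr_wpDl// !mulr_ge0 ?fnorm_ge0// ltW.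
rewrite GE -/(e k) /hessh_plus; set dd := \row_i _; split=> [|v].
  by rewrite linearD/= tr_scalar_mx !trmx_mul trmxK tr_diag_mx mulmxA.
have ek0 := e_ge0 k; have v0 := enorm_ge0 v.
have ddE i : dd 0 i = Num.max (hs2 i ((A *m x k - b) i 0)) 0 by rewrite mxE.
have dd0 i : 0 <= dd 0 i by rewrite ddE le_max lexx orbT.
have ddK i : `|dd 0 i| <= K.
  rewrite ger0_norm// ddE ge_max (ltW K0) andbT.
  by rewrite (le_trans (ler_norm _))// hK.
have AA : dotp (A^T *m diag_mx dd *m A *m v) v =
    \sum_i dd 0 i * (A *m v) i 0 ^+ 2.
  rewrite -!mulmxA dotp_adj trmxK; apply: eq_bigr => i _.
  by rewrite diag_mulE -mulrA expr2.
rewrite mulmxBl mulmxDl mul_scalar_mx; split.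
- rewrite !dotp_lin AA -enorm_sqr lerDr.
  by apply: sumr_ge0 => i _; rewrite mulr_ge0// sqr_ge0.
(* [G - H] is [A^T ([D]_+ - D) A] plus the shift; both forms are sums over the entries of [A *m v],
   so the comparison is termwise. *)
- rewrite !dotp_lin AA (sep_hessian_quad C2 sep) -enorm_sqr addrAC lerDr subr_ge0.
  by apply: ler_sum => i _; rewrite ler_wpM2r ?sqr_ge0// ddE le_max lexx.
- rewrite (le_trans (enormD _ _))// enormZ (ger0_norm ek0) -!mulmxA.
  have := enorm_mulmx A^T (diag_mx dd *m (A *m v)).
  have F0 := fnorm_ge0 A^T.
  have := ler_wpM2l F0 (enorm_diag_le (A *m v) (ltW K0) ddK).
  have := ler_wpM2l (mulr_ge0 F0 (ltW K0)) (enorm_mulmx A v).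
  by rewrite /M; lra.
Qed.

End Separable.
End NewtonMatrix.

(** * Normal cones, limiting subgradients and active faces *)

Section NormalCone.
Context {R : realType} {n : nat}.
Implicit Types (C : set 'cV[R]_n) (x y z v w : 'cV[R]_n).

(** Let [t] tend to 0. This turns perturbations of size [t] into first-order inequalities throughout
    what follows. *)
Lemma le0_small_multiples (a c : R) :
  (forall t : R, 0 < t <= 1 -> a <= t * c) -> a <= 0.
Proof.
move=> H; apply/ler_addgt0Pr => e e0; rewrite add0r.
have c1 : 0 < `|c| + 1 by rewrite ltr_wpDl.
have t0 : 0 < Num.min 1 (e / (`|c| + 1)) by rewrite lt_min ltr01 divr_gt0.
have t1 : 0 < Num.min 1 (e / (`|c| + 1)) <= 1 by rewrite t0 ge_min lexx.
apply: (le_trans (H _ t1)); apply: (@le_trans _ _ (Num.min 1 (e / (`|c| + 1)) * (`|c| + 1))).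
  by rewrite ler_wpM2l ?(ltW t0)// (le_trans (ler_norm _))// lerDl.
by rewrite -ler_pdivlMr// ge_min lexx orbT.
Qed.

(** Closed graph of the normal cone: replacing [(y, w)] by a normal pair within [t] costs an error
    of order [t]. Limiting subgradients need this because their base points move. *)
Lemma normal_cone_closed C y w : C y ->
  (forall e : R, 0 < e -> exists y' w', [/\ enorm (y' - y) < e, enorm (w' - w) < e &
     normal_cone C y' w']) ->
  normal_cone C y w.
Proof.
move=> Cy H; split=> // z Cz; apply: (@le0_small_multiples _ (enorm (z - y) + enorm w + 1)).
move=> t /andP[t0 t1]; have [y' [w' [yy ww [Cy' /(_ z Cz) le0]]]] := H t t0.
have -> : dotp w (z - y) = dotp w' (z - y') + dotp (w - w') (z - y) + dotp w' (y' - y).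
  by rewrite !dotp_lin; ring.
have w't : enorm w' <= enorm w + 1.
  by have := enormD (w' - w) w; rewrite subrK; lra.
have := dotp_le (w - w') (z - y); have := dotp_le w' (y' - y); rewrite (enormB w).
have := ler_wpM2r (enorm_ge0 (z - y)) (ltW ww).
have := ler_wpM2r (enorm_ge0 (y' - y)) w't.
have w1 : 0 <= enorm w + 1 by rewrite addr_ge0 ?enorm_ge0.
by have := ler_wpM2l w1 (ltW yy); lra.
Qed.

Lemma frechet_sub_indic C (q : 'cV[R]_n -> R) dq x v : vconvex C -> has_grad q dq ->
  frechet_sub (indic_plus C q) x v -> normal_cone C x (v - dq x).
Proof.
move=> Ccv dqP [+ vP]; rewrite /indic_plus; case: ifPn => [|//] xC _.
have Cx : C x by rewrite -in_setE.
split=> // z Cz; apply: (@le0_small_multiples _ (2 * enorm (z - x))) => e /andP[e0 _].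
have [d1 [d10 d1P]] := vP e e0; have [d2 [d20 d2P]] := dqP x e e0.
have zx1 : 0 < enorm (z - x) + 1 by rewrite ltr_wpDl ?enorm_ge0.
pose d := Num.min d1 d2; have d0 : 0 < d by rewrite lt_min d10.
pose t := Num.min 1 (d / (enorm (z - x) + 1)).
have t0 : 0 < t by rewrite lt_min ltr01 divr_gt0.
have t1 : t <= 1 by rewrite ge_min lexx.
have td : t * enorm (z - x) < d.
  apply: (@lt_le_trans _ _ (t * (enorm (z - x) + 1))); first by rewrite ltr_pM2l// ltrDl.
  by rewrite -ler_pdivlMr// ge_min lexx orbT.
have Ey : x + t *: (z - x) - x = t *: (z - x) by rewrite addrC addKr.
have Ny : enorm (t *: (z - x)) = t * enorm (z - x) by rewrite enormZ gtr0_norm.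
have := d1P (x + t *: (z - x)); rewrite Ey Ny.
move=> /(_ (lt_le_trans td _)); rewrite ge_min lexx => /(_ isT).
rewrite /indic_plus mem_set// mem_set; last by apply: Ccv => //; rewrite ltW.
rewrite -EFinD lee_fin dotpZr => le1.
have := d2P (t *: (z - x)); rewrite Ny.
move=> /(_ (lt_le_trans td _)); rewrite ge_min lexx orbT => /(_ isT).
rewrite dotpZr ler_norml => /andP[_ le2].
rewrite -(ler_pM2l t0) dotpBl; lra.
Qed.

(** This direction reads the inexactness test of the Newton subproblem, stated with limiting
    subgradients, as a normal cone relation. *)
Lemma lim_sub_indic C (q : 'cV[R]_n -> R) dq x v : vconvex C -> has_grad q dq ->
  (forall e : R, 0 < e -> exists2 d : R, 0 < d & forall y, enorm (y - x) < d ->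
     enorm (dq y - dq x) < e) ->
  lim_sub (indic_plus C q) x v -> normal_cone C x (v - dq x).
Proof.
move=> Ccv dqP dqc [hx [xs [vs [xsx [vsv [fr _]]]]]].
apply: normal_cone_closed => [|e e0].
  by move: hx; rewrite /indic_plus; case: ifPn => // xC _; rewrite -in_setE.
have e2 : 0 < e / 2 by rewrite divr_gt0.
have [d d0 dP] := dqc _ e2.
have [N1 N1P] := xsx (Num.min e d) ltac:(by rewrite lt_min e0).
have [N2 N2P] := vsv _ e2.
have := N1P _ (leq_maxl N1 N2); have := N2P _ (leq_maxr N1 N2).
set k := maxn N1 N2; rewrite lt_min => vk /andP[xe xd].
exists (xs k), (vs k - dq (xs k)); split=> //; last exact: frechet_sub_indic (fr k).
have -> : vs k - dq (xs k) - (v - dq x) = (vs k - v) - (dq (xs k) - dq x).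
  by rewrite !opprD !opprK [LHS]addrACA.
by have := enormD (vs k - v) (- (dq (xs k) - dq x)); rewrite enormN; have := dP _ xd; lra.
Qed.

(** Constant sequences suffice, since these vectors are already Frechet subgradients. This direction
    bounds [dist0] from above in the Kurdyka-Lojasiewicz inequality. *)
Lemma mem_lim_sub_indic C (q : 'cV[R]_n -> R) dq x w : has_grad q dq ->
  normal_cone C x w -> lim_sub (indic_plus C q) x (dq x + w).
Proof.
move=> dqP [Cx wP].
have fx : indic_plus C q x \is a fin_num by rewrite /indic_plus mem_set.
have cst (z : 'cV[R]_n) : vconv (fun=> z) z.
  by move=> e e0; exists 0%N => k _; rewrite subrr enorm0.
split=> //; exists (fun=> x), (fun=> dq x + w); split=> //; split=> //.
split; last by move=> e e0; exists 0%N => k _; rewrite subrr normr0.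
move=> _; split=> // e e0; have [d [d0 dP]] := dqP x e e0.
exists d; split=> // y yx; rewrite /indic_plus mem_set//.
case: ifPn => [|_]; last exact: leey.
rewrite in_setE => Cy; rewrite -EFinD lee_fin dotpDl.
have := dP (y - x) yx; rewrite [x + _]addrC subrK ler_norml => /andP[+ _].
by have := wP y Cy; lra.
Qed.

Lemma dist0_le (S : set 'cV[R]_n) v : S v -> (dist0 S <= (enorm v)%:E)%E.
Proof. by move=> Sv; apply: ereal_inf_lbound; exists v. Qed.

(** The infimum in [dist0] is not known to be attained, so a subgradient is obtained only at the
    price of the slack [c < c']. *)
Lemma dist0_lt (S : set 'cV[R]_n) (c c' : R) : (dist0 S <= c%:E)%E -> c < c' ->
  exists2 v, S v & enorm v < c'.
Proof.
move=> Sc cc'; have : (dist0 S < c'%:E)%E by apply: le_lt_trans Sc _; rewrite lte_fin.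
by move=> /ereal_inf_lt[_ [v Sv <-]]; rewrite lte_fin; exists v.
Qed.

End NormalCone.

(** * The polyhedral sets [PiSet] and identification of their active faces *)

Section PiSets.
Context {R : realType} {n p : nat}.
Variables (B : 'M[R]_(p, n)) (l u : 'cV[R]_n).
Implicit Types (x y z v w : 'cV[R]_n).

Lemma PiSetP z x : PiSet B l u z x <-> [/\ box l u x,
  forall i, z i 0 = 0 -> x i 0 = 0 & forall j, (B *m z) j 0 = 0 -> (B *m x) j 0 = 0].
Proof.
rewrite /PiSet/=; split=> [[xb [/fintype.subsetP s1 /fintype.subsetP s2]]|[xb s1 s2]].
  split=> // i zi; apply/eqP; apply: contraT => xi.
  - by have := s1 i; rewrite !inE zi eqxx xi => /(_ isT).
  - by have := s2 i; rewrite !inE zi eqxx xi => /(_ isT).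
by split=> //; split; apply/fintype.subsetP => i; rewrite !inE; apply: contraNN => /eqP H;
   apply/eqP; auto.
Qed.

Lemma box_convex : vconvex (box l u).
Proof.
move=> y z t yb zb /andP[t0 t1] i; rewrite !mxE.
have /andP[y1 y2] := yb i; have /andP[z1 z2] := zb i.
have t1' : 0 <= 1 - t by rewrite subr_ge0.
have -> : y i 0 + t * (z i 0 - y i 0) = (1 - t) * y i 0 + t * z i 0 by ring.
have := ler_wpM2l t0 z1; have := ler_wpM2l t0 z2.
have := ler_wpM2l t1' y1; have := ler_wpM2l t1' y2.
by move=> *; apply/andP; split; lra.
Qed.

Lemma PiSet_convex z : vconvex (PiSet B l u z).
Proof.
move=> y y' t /PiSetP[yb y1 y2] /PiSetP[y'b y1' y2'] t01; apply/PiSetP; split.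
- exact: box_convex.
- by move=> i zi; rewrite !mxE y1// y1'// subrr mulr0 addr0.
- move=> j zj; rewrite mulmxDr -scalemxAr mulmxBr mxE y2// add0r mxE mxE.
  by rewrite y2'// mxE y2// subrr mulr0.
Qed.

Lemma PiSet_closed z : vclosed (PiSet B l u z).
Proof.
move=> x xC; apply/PiSetP.
have small (a : R) : (forall e : R, 0 < e -> `|a| < e) -> a = 0.
  move=> H; apply/eqP; rewrite -normr_le0; apply/ler_addgt0Pr => e /H.
  by rewrite add0r => /ltW.
split.
- apply: box_closed => e /xC[y yC yx]; exists y => //.
  by case/PiSetP: yC.
- move=> i zi; apply: small => e /xC[y /PiSetP[_ /(_ i zi) yi _]] yx.
  apply: le_lt_trans yx; rewrite -normrN -[- _]add0r -yi.
  by rewrite (le_trans _ (coord_le_enorm _ i))// !mxE.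
- move=> j zj; apply: small => e e0; have B1 : 0 < fnorm B + 1.
    by rewrite ltr_wpDl ?fnorm_ge0.
  have [|y /PiSetP[_ _ /(_ j zj) yj] yx] := xC (e / (fnorm B + 1)); first by rewrite divr_gt0.
  move: yx; rewrite ltr_pdivlMr// => yx.
  rewrite -normrN -[- _]add0r -yj.
  have -> : (B *m y) j 0 - (B *m x) j 0 = (B *m (y - x)) j 0 by rewrite mulmxBr !mxE.
  apply: le_lt_trans (coord_le_enorm _ j) _.
  apply: le_lt_trans (enorm_mulmx _ _) _.
  by have := enorm_ge0 (y - x); lra.
Qed.

Lemma PiSet_self z : box l u z -> PiSet B l u z z.
Proof. by move=> zb; apply/PiSetP. Qed.

Lemma PiSet_box z x : PiSet B l u z x -> box l u x.
Proof. by case/PiSetP. Qed.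

Lemma PiSet_inj x y : box l u x -> box l u y -> PiSet B l u x = PiSet B l u y ->
  supp x = supp y /\ supp (B *m x) = supp (B *m y).
Proof.
move=> xb yb E; have [_ [s1 s2]] : PiSet B l u y x by rewrite -E; exact: PiSet_self.
have [_ [s3 s4]] : PiSet B l u x y by rewrite E; exact: PiSet_self.
by split; apply/eqP; rewrite finset.eqEsubset ?s1 ?s2.
Qed.

(** Points of one [PiSet] share its linear support equations, so their faces differ only in the
    tight upper and lower bounds, recorded in this order. *)
Definition active y : {set 'I_n} * {set 'I_n} :=
  ([set i | y i 0 == u i 0], [set i | y i 0 == l i 0])%SET.

Definition active_sub (I J : {set 'I_n} * {set 'I_n}) :=
  (I.1 \subset J.1) && (I.2 \subset J.2).

Lemma active_subP y (J : {set 'I_n} * {set 'I_n}) : reflect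
  ((forall i, y i 0 = u i 0 -> i \in J.1) /\ (forall i, y i 0 = l i 0 -> i \in J.2))
  (active_sub (active y) J).
Proof.
apply: (iffP andP) => -[].
  by move=> /fintype.subsetP s1 /fintype.subsetP s2; split=> i yi;
     [apply: s1|apply: s2]; rewrite inE yi.
by move=> s1 s2; split; apply/fintype.subsetP => i; rewrite inE => /eqP; auto.
Qed.

(** For [x] in the set, [x - y'] is a feasible direction at [y]: where a bound is tight at [y] it is
    tight at [y'] and the direction points inward, and elsewhere there is room for a small step
    [t]. *)
Lemma normal_cone_active z y y' : let C := PiSet B l u z in
  C y -> C y' -> active_sub (active y) (active y') ->
  normal_cone C y `<=` normal_cone C y'.
Proof.
move=> C Cy Cy' /active_subP[su sl] w [_ wP]; split=> // x Cx.
have [yb y1 y2] := (PiSetP z y).1 Cy; have [y'b y'1 y'2] := (PiSetP z y').1 Cy'.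
have [xb x1 x2] := (PiSetP z x).1 Cx.
have [|i|t t0 tP] := @fin_radius R 'I_n
  (fun i d => forall t, 0 < t <= d -> l i 0 <= y i 0 + t * (x i 0 - y' i 0) <= u i 0).
- move=> i d d' dd dP t /andP[t0 td]; apply: dP; rewrite t0/=; exact: le_trans dd.
- have /andP[yl yu] := yb i; have /andP[yl' yu'] := y'b i; have /andP[xl xu] := xb i.
  (* The summand 1 keeps the quotient of slack by displacement meaningful when the coordinate does
     not move. *)
  pose m := 1 + `|x i 0 - y' i 0|; have m0 : 0 < m by rewrite ltr_wpDr.
  pose du := if y i 0 == u i 0 then 1 else (u i 0 - y i 0) / m.
  pose dl := if y i 0 == l i 0 then 1 else (y i 0 - l i 0) / m.
  exists (Num.min du dl).
    rewrite lt_min /du /dl; apply/andP; split; case: ifPn => // H; rewrite divr_gt0//.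
      by rewrite subr_gt0 lt_neqAle H.
    by rewrite subr_gt0 lt_neqAle eq_sym H.
  move=> t /andP[t0]; rewrite le_min => /andP[tu tl].
  have tm : t * `|x i 0 - y' i 0| <= t * m by rewrite ler_pM2l// lerDr.
  apply/andP; split.
  + move: tl; rewrite /dl; case: eqVneq => [yE _|_].
      have := sl i yE; rewrite inE => /eqP ->.
      by rewrite yE lerDl mulr_ge0 ?(ltW t0)// subr_ge0.
    rewrite ler_pdivlMr// => tl.
    have := ler_wpM2l (ltW t0) (ler_norm (- (x i 0 - y' i 0))); rewrite normrN; lra.
  + move: tu; rewrite /du; case: eqVneq => [yE _|_].
      have := su i yE; rewrite inE => /eqP ->.
      by rewrite yE gerDl mulr_ge0_le0 ?(ltW t0)// subr_le0.
    rewrite ler_pdivlMr// => tu.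
    have := ler_wpM2l (ltW t0) (ler_norm (x i 0 - y' i 0)); lra.
have Cyt : C (y + t *: (x - y')).
  apply/PiSetP; split.
  - by move=> i; rewrite !mxE; apply: tP; rewrite t0 lexx.
  - by move=> i zi; rewrite !mxE y1// x1// y'1// subrr mulr0 addr0.
  - move=> j zj; rewrite mulmxDr -scalemxAr mulmxBr mxE y2// add0r mxE mxE.
    by rewrite x2// mxE y'2// subrr mulr0.
by have := wP _ Cyt; rewrite addrC addKr dotpZr pmulr_rle0.
Qed.

(** Relative interiority allows moving from [v] slightly away from [w]: [v + e (v - w)], an affine
    combination of [v] and [w], is still normal at [x]. Since [v] is also normal at [y],
    [<v, y - x>] is nonnegative and forces the sign for [w]. *)
Lemma rel_int_dotp_ge0 (C : set 'cV[R]_n) x y v w :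
  rel_int (normal_cone C x) v -> normal_cone C y v -> normal_cone C x w ->
  0 <= dotp w (y - x).
Proof.
move=> [[Cx vP] [r [r0 rP]]] [Cy vyP] wN.
have m0 : 0 < enorm (v - w) + 1 by rewrite ltr_wpDl ?enorm_ge0.
pose e := r / (enorm (v - w) + 1); have e0 : 0 < e by rewrite divr_gt0.
have aff : aff_hull (normal_cone C x) (v + e *: (v - w)).
  exists 2%N, (fun i => if i == ord0 then v else w), (fun i => if i == ord0 then 1 + e else - e).
  split; first by move=> i; case: ifP.
  rewrite !big_ord_recl !big_ord0 /= addr0; split; first by ring.
  by rewrite addr0 scalerDl scale1r scalerBr scaleNr addrA.
have [|_ /(_ y Cy)] := rP _ aff.
  rewrite addrC addKr enormZ gtr0_norm// /e -mulrA gtr_pMr//.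
  by rewrite ltr_pdivrMl// mulr1 ltrDl.
have v1 := vyP x Cx; rewrite -[x - y]opprB dotpNr oppr_le0 in v1.
rewrite dotpDl dotpZl dotpBl => v2.
have ev : 0 <= e * dotp v (y - x) by rewrite mulr_ge0// ltW.
by rewrite -(pmulr_rge0 _ e0); lra.
Qed.

(** [rel_int_dotp_ge0] applied to the signed unit vectors, which are the normals of the bounds tight
    at [x]. *)
Lemma rel_int_active z x y v : let C := PiSet B l u z in
  rel_int (normal_cone C x) v -> normal_cone C y v -> active_sub (active x) (active y).
Proof.
move=> C vri vy; have [[Cx _] _] := vri; have [Cy _] := vy.
have deltaE i w : dotp (delta_mx i 0) w = w i 0.
  rewrite /dotp (bigD1 i)//= big1 ?addr0 => [|j /negPf ji]; first by rewrite mxE !eqxx mul1r.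
  by rewrite mxE ji mul0r.
have yb := PiSet_box Cy; apply/active_subP; split=> i xi; rewrite inE eq_le.
- have : normal_cone C x (delta_mx i 0).
    split=> // x' /PiSet_box/(_ i)/andP[_ ?]; rewrite deltaE !mxE xi; lra.
  move=> /(rel_int_dotp_ge0 vri vy); rewrite deltaE !mxE xi.
  by have /andP[_ ->] := yb i; rewrite subr_ge0.
- have : normal_cone C x (- delta_mx i 0).
    split=> // x' /PiSet_box/(_ i)/andP[? _]; rewrite dotpNl deltaE !mxE xi; lra.
  move=> /(rel_int_dotp_ge0 vri vy); rewrite dotpNl deltaE !mxE xi.
  by have /andP[-> _] := yb i; rewrite andbT oppr_ge0 subr_le0.
Qed.

(* Identification of the active face: there are finitely many active sets, and a
   normal cone depends on the active set only.  If [v] is not in the closed cone of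
   an active set, normals near [v] are not either; otherwise relative interiority
   of [v] forces the constraints active at [x] to be active. *)
Lemma active_identification z x v : let C := PiSet B l u z in
  rel_int (normal_cone C x) v ->
  exists2 d : R, 0 < d & forall y w, enorm (y - x) < d -> enorm (w - v) < d ->
    normal_cone C y w -> active y = active x.
Proof.
move=> C vri.
have [|I|d1 d10 d1P] := @fin_radius R _ (fun I d => forall y w, active y = I ->
    enorm (w - v) < d -> normal_cone C y w -> active_sub (active x) I).
- by move=> I d d' dd dP y w yI wv; apply: dP => //; exact: lt_le_trans dd.
- have [[y0 [Cy0 y0I]]|noy] := pselect (exists y0, C y0 /\ active y0 = I); last first.
    by exists 1 => // y w yI _ [Cy _]; exfalso; apply: noy; exists y.
  have [vy0|vy0] := pselect (normal_cone C y0 v).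
    by exists 1 => // y w _ _ _; rewrite -y0I; exact: rel_int_active vri vy0.
  have [x' [Cx' x'P]] : exists x', C x' /\ 0 < dotp v (x' - y0).
    apply: contrapT => /forallNP H; apply: vy0; split=> // x' Cx'.
    by rewrite leNgt; apply/negP => ?; apply: (H x').
  have m0 : 0 < enorm (x' - y0) + 1 by rewrite ltr_wpDl ?enorm_ge0.
  exists (dotp v (x' - y0) / (enorm (x' - y0) + 1)); first by rewrite divr_gt0.
  move=> y w yI; rewrite ltr_pdivlMr// => wv wN; exfalso.
  have : normal_cone C y0 w.
    apply: normal_cone_active (wN) => //; first by case: wN.
    by rewrite yI y0I /active_sub !fintype.subxx.
  move=> [_ /(_ x' Cx')] wx'; have := dotp_ge (w - v) (x' - y0).
  by rewrite dotpBl; have := enorm_ge0 (w - v); lra.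
(* The converse inclusion is continuity alone: bounds that are slack at [x] stay slack nearby. *)
have [|i|d2 d20 d2P] := @fin_radius R 'I_n (fun i d => forall y, enorm (y - x) < d ->
    (y i 0 = u i 0 -> x i 0 = u i 0) /\ (y i 0 = l i 0 -> x i 0 = l i 0)).
- by move=> i d d' dd dP y yx; apply: dP; exact: lt_le_trans dd.
- have coord y (a d : R) : enorm (y - x) < d -> d <= `|a - x i 0| -> y i 0 <> a.
    move=> yx da ya; have := coord_le_enorm (y - x) i; rewrite !mxE ya; lra.
  pose r (a : R) := if x i 0 == a then 1 else `|a - x i 0|.
  have r0 a : 0 < r a by rewrite /r; case: ifPn => // xa; rewrite normr_gt0 subr_eq0 eq_sym.
  exists (Num.min (r (u i 0)) (r (l i 0))); first by rewrite lt_min !r0.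
  move=> y; rewrite lt_min => /andP[yu yl]; split=> yi; apply/eqP; apply: contraT => xi;
    exfalso; [move: yu|move: yl]; rewrite /r (negPf xi) => yx; exact: coord yx _ yi.
exists (Num.min d1 d2) => [|y w]; first by rewrite lt_min d10.
rewrite !lt_min => /andP[_ yx] /andP[wv _] yw.
have /andP[s1 s2] := d1P (active y) y w erefl wv yw.
have /andP[s3 s4] : active_sub (active y) (active x).
  by apply/active_subP; split=> i yi; rewrite inE; apply/eqP; have := d2P i y yx; tauto.
by apply/eqP; rewrite -pair_eqE /= /pair_eq !finset.eqEsubset s1 s2 s3 s4.
Qed.

End PiSets.

(** * Proximal steps *)

Section Prox.
Context {R : realType} {n p : nat}.
Variables (B : 'M[R]_(p, n)) (lam1 lam2 : R) (l u : 'cV[R]_n).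
Hypotheses (lam1_gt0 : 0 < lam1) (lam2_gt0 : 0 < lam2).
Implicit Types (x y z w : 'cV[R]_n).

Let g := gfun B lam1 lam2 l u.
Let card x : R := lam1 * l0 (B *m x) + lam2 * l0 x.

Lemma gfun_box x : box l u x -> g x = (card x)%:E.
Proof. by move=> xb; rewrite /g /gfun mem_set. Qed.

Lemma gfun_out x : ~ box l u x -> g x = +oo%E.
Proof. by move=> xb; rewrite /g /gfun memNset. Qed.

Lemma card_le x y : supp x \subset supp y -> supp (B *m x) \subset supp (B *m y) ->
  card x <= card y.
Proof.
by move=> s1 s2; rewrite lerD// ler_wpM2l ?(ltW lam1_gt0) ?(ltW lam2_gt0)// ler_nat subset_leq_card.
Qed.

Lemma prox_box mu w z y : box l u y -> prox_inv mu g w z -> box l u z.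
Proof.
move=> yb /(_ y); rewrite (gfun_box yb); have [//|zb] := pselect (box l u z).
by rewrite gfun_out// addey// -EFinD leye_eq.
Qed.

Lemma prox_le mu w z y : box l u y -> prox_inv mu g w z ->
  mu / 2 * enorm (z - w) ^+ 2 + card z <= mu / 2 * enorm (y - w) ^+ 2 + card y.
Proof.
move=> yb zw; have zb := prox_box yb zw; have := zw y.
by rewrite !gfun_box// -!EFinD lee_fin.
Qed.

Lemma supp_subP {k} (x z : 'cV[R]_k) :
  reflect (forall i, z i 0 = 0 -> x i 0 = 0) (supp x \subset supp z).
Proof.
apply: (iffP fintype.subsetP) => H i.
  by move=> zi; apply/eqP; apply: contraT => xi; have := H i;
     rewrite !inE zi eqxx xi => /(_ isT).
by rewrite !inE; apply: contraNN => /eqP/H ->.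
Qed.

Lemma mulmx_coord_bound {k} (M : 'M[R]_(k, n)) x i (e : R) : 0 < e ->
  exists2 d : R, 0 < d & forall y, enorm (y - x) < d -> `|(M *m y) i 0 - (M *m x) i 0| < e.
Proof.
move=> e0; have M1 : 0 < fnorm M + 1 by rewrite ltr_wpDl ?fnorm_ge0.
exists (e / (fnorm M + 1)) => [|y]; first by rewrite divr_gt0.
rewrite ltr_pdivlMr// => yx.
have -> : (M *m y) i 0 - (M *m x) i 0 = (M *m (y - x)) i 0 by rewrite mulmxBr !mxE.
apply: le_lt_trans (coord_le_enorm _ _) _; apply: le_lt_trans (enorm_mulmx _ _) _.
by have := enorm_ge0 (y - x); lra.
Qed.

Lemma supp_lsc {k} (M : 'M[R]_(k, n)) x : exists2 d : R, 0 < d & forall y,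
  enorm (y - x) < d -> supp (M *m x) \subset supp (M *m y).
Proof.
have [|i|d d0 dP] := @fin_radius R 'I_k (fun i d => forall y, enorm (y - x) < d ->
    (M *m y) i 0 = 0 -> (M *m x) i 0 = 0).
- by move=> i d d' dd dP y yx; apply: dP; exact: lt_le_trans dd.
- have [x0|/eqP x0] := eqVneq ((M *m x) i 0) 0; first by exists 1.
  have [|d d0 dP] := @mulmx_coord_bound _ M x i `|(M *m x) i 0|.
    by rewrite normr_gt0; apply/eqP.
  by exists d => // y /dP + y0; rewrite y0 add0r normrN ltxx.
by exists d => // y yx; apply/supp_subP => i; exact: dP.
Qed.

(** The support counts are not continuous. The box is covered by finitely many closed pieces [K I]
    on which the supports are confined to [I]; the distance to [w] is minimized on each piece, then
    the finitely many values are compared. *)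
Lemma prox_exists mu w : 0 < mu -> box l u 0 -> exists z, prox_inv mu g w z.
Proof.
move=> mu0 b0.
pose K (I : {set 'I_n} * {set 'I_p}) : set 'cV[R]_n :=
  [set x | [/\ box l u x, supp x \subset I.1 & supp (B *m x) \subset I.2]].
have Kbox I : K I `<=` box l u by move=> x [].
have Kcl I : vclosed (K I).
  move=> x xK; split.
  - by apply: box_closed => e /xK[y [yb _ _] yx]; exists y.
  - have [d d0 dP] := supp_lsc 1%:M x; have [y [_ s _] /dP] := xK d d0.
    by rewrite !mul1mx => /fintype.subset_trans; exact.
  - have [d d0 dP] := supp_lsc B x; have [y [_ _ s] /dP] := xK d d0.
    by move=> /fintype.subset_trans; exact.
have K0 I : K I !=set0.
  exists 0; split=> //; first by apply/fintype.subsetP => i; rewrite inE mxE eqxx.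
  by apply/fintype.subsetP => i; rewrite inE mulmx0 mxE eqxx.
have qc z : vcontinuous_at (fun x => enorm (x - w)) z.
  move=> e e0; exists e => // y yz; apply: le_lt_trans (enorm_lipschitz _ _) _.
  by rewrite opprB addrA subrK.
have ex I : exists z, K I z /\ forall y, K I y -> enorm (z - w) <= enorm (y - w).
  by have [z ? ?] := min_attained (Kbox I) (Kcl I) qc (K0 I); exists z.
have [zz zzP] := choice ex.
pose val (I : {set 'I_n} * {set 'I_p}) : R :=
  mu / 2 * enorm (zz I - w) ^+ 2 + (lam1 * #|I.2|%:R + lam2 * #|I.1|%:R).
pose I0 := [arg min_(I < (finset.set0, finset.set0)) val I]%O.
have I0P I : val I0 <= val I by rewrite /I0; case: Order.TotalTheory.arg_minP => // J _; apply.
exists (zz I0) => y; have [yb|yb] := pselect (box l u y); last first.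
  by rewrite [g y]gfun_out// addey// leey.
have [[zb z1 z2] _] := zzP I0.
(* [val I] counts the allowed supports, so it overestimates the objective at [zz I]; at the exact
   supports of [y] it is at most the objective at [y]. *)
rewrite !gfun_box// -!EFinD lee_fin; apply: (@le_trans _ _ (val I0)).
  by rewrite lerD2l /card /l0 lerD// ler_wpM2l ?(ltW lam1_gt0) ?(ltW lam2_gt0)// ler_nat subset_leq_card.
apply: (le_trans (I0P (supp y, supp (B *m y)))); rewrite lerD2r.
rewrite ler_wpM2l ?divr_ge0 ?(ltW mu0)// ler_pXn2r ?nnegrE ?enorm_ge0//.
by apply: (zzP _).2; split.
Qed.

Lemma prox_shift mu x z v : 0 < mu ->
  mu / 2 * enorm (z - (x - mu^-1 *: v)) ^+ 2 =
  mu / 2 * enorm (z - x) ^+ 2 + dotp v (z - x) + enorm v ^+ 2 / (2 * mu).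
Proof.
move=> mu0; have -> : z - (x - mu^-1 *: v) = (z - x) + mu^-1 *: v.
  by rewrite opprB addrCA addrC.
rewrite !enorm_sqr [in LHS]dotpDl !(dotpDr _ (z - x)) !dotpZl !dotpZr (dotpC (z - x) v).
by field; rewrite gt_eqF.
Qed.

Lemma prox_grad_le mu x z v y : 0 < mu -> box l u y ->
  prox_inv mu g (x - mu^-1 *: v) z ->
  mu / 2 * enorm (z - x) ^+ 2 + dotp v (z - x) + card z <=
  mu / 2 * enorm (y - x) ^+ 2 + dotp v (y - x) + card y.
Proof.
move=> mu0 yb /(prox_le yb).
by rewrite (prox_shift x z v mu0) (prox_shift x y v mu0) !(addrAC _ (enorm v ^+ 2 / _)) lerD2r.
Qed.

(** Within [PiSet B l u x] the support counts cannot exceed those of [z], so [z] minimizes the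
    smooth part over this convex set, and the inclusion is its first-order condition. *)
Lemma prox_normal_cone mu x z v : 0 < mu -> box l u x ->
  prox_inv mu g (x - mu^-1 *: v) z -> supp x = supp z -> supp (B *m x) = supp (B *m z) ->
  normal_cone (PiSet B l u x) z (mu *: (x - z) - v).
Proof.
move=> mu0 xb zP s1 s2; have zb := prox_box xb zP.
have Cz : PiSet B l u x z by split=> //; rewrite s1 s2 !fintype.subxx.
split=> // y Cy; apply: (@le0_small_multiples _ _ (mu / 2 * enorm (y - z) ^+ 2)) => t t01.
have Ct : PiSet B l u x (z + t *: (y - z)).
  by apply: PiSet_convex => //; case/andP: t01 => /ltW -> ->.
have [tb [ts1 ts2]] := Ct.
have := prox_grad_le mu0 tb zP.
have : card (z + t *: (y - z)) <= card z by apply: card_le; rewrite -?s1 -?s2.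
have -> : z + t *: (y - z) - x = (z - x) + t *: (y - z) by rewrite addrAC.
rewrite -(opprB z x); case/andP: t01 => t0 _; move: (z - x) (y - z) => a b.
rewrite !enorm_sqr !dotp_lin (dotpC b a) => c1 c2.
by rewrite -(ler_pM2l t0); lra.
Qed.

(** The descent lemma: the proximal inequality gains [mu / 2] while the Taylor remainder on the
    segment, which stays in the box, costs [L / 2]. *)
Lemma prox_sufficient_decrease (f : 'cV[R]_n -> R) gradf hessf (L alpha mu : R) x z :
  C2_with f gradf hessf ->
  (forall y, box l u y -> forall v, enorm (hessf y *m v) <= L * enorm v) ->
  0 < mu -> L + alpha <= mu -> box l u x ->
  prox_inv mu g (x - mu^-1 *: gradf x) z ->
  ((f z)%:E + g z <= (f x)%:E + g x - (alpha / 2 * enorm (x - z) ^+ 2)%:E)%E.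
Proof.
move=> C2 HL mu0 muL xb zP; have zb := prox_box xb zP.
rewrite !gfun_box// -!EFinD lee_fin.
have := prox_grad_le mu0 xb zP; rewrite subrr enorm0 expr0n dotp0r mulr0 !add0r => pl.
have := second_order_le (x := x) (v := z - x) (M := L * enorm (z - x) ^+ 2) C2.
rewrite [x + (z - x)]addrC subrK => taylor.
have {}taylor : f z <= f x + dotp (gradf x) (z - x) + L * enorm (z - x) ^+ 2 / 2.
  apply: taylor => t /andP[t0 t1].
  have tb : box l u (x + t *: (z - x)) by apply: box_convex => //; rewrite !ltW.
  apply: (le_trans (dotp_le _ _)); rewrite expr2 mulrA.
  by rewrite ler_wpM2r ?enorm_ge0// HL.
have z2 : 0 <= enorm (z - x) ^+ 2 by rewrite exprn_ge0 ?enorm_ge0.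
have := ler_wpM2r z2 muL; rewrite (enormB x z); lra.
Qed.

(* Enlarging the proximal parameter weakens the condition at a fixed point, so an
   upper bound of the parameters works in the limit and no subsequence is needed. *)
Lemma Lstationary_limit (f : 'cV[R]_n -> R) gradf hessf (x xb : nat -> 'cV[R]_n)
    (m : nat -> R) (mhi : R) xs :
  has_jac gradf hessf -> 0 < mhi -> box l u xs -> vconv x xs ->
  (forall e : R, 0 < e -> \forall k \near \oo, enorm (xb k - x k) < e) ->
  (\forall k \near \oo, 0 < m k <= mhi) ->
  (forall k, prox_inv (m k) g (x k - (m k)^-1 *: gradf (x k)) (xb k)) ->
  Lstationary f gradf g xs.
Proof.
move=> gH mhi0 xsb xsx xbx mk xbP; exists mhi; split=> // y.
have [yb|yb] := pselect (box l u y); last by rewrite [g y]gfun_out// addey// leey.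
rewrite !gfun_box// -!EFinD lee_fin; set v := gradf xs.
rewrite (prox_shift xs xs v mhi0) (prox_shift xs y v mhi0) subrr enorm0 expr0n dotp0r mulr0 !add0r.
suff H : card xs <= mhi / 2 * enorm (y - xs) ^+ 2 + dotp v (y - xs) + card y.
  by rewrite addrAC [leLHS]addrC lerD2r.
rewrite -subr_le0; pose a := enorm (y - xs).
(* Errors at scale [t]: enlarging the square to [(a + t) ^ 2], the gradient error against [y - x N],
   two displacements paired with [v], and the gradient error against [xb N - x N]. *)
apply: (@le0_small_multiples _ _ (mhi / 2 * (2 * a + 1) + (a + 1) + 2 * enorm v + 1)).
move=> t /andP[t0 t1]; have [d d0 dP] := grad_continuous_at xs gH t0.
have [d1 d10 d1P] := supp_lsc 1%:M xs; have [d2 d20 d2P] := supp_lsc B xs.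
pose e := Num.min (Num.min t d) (Num.min (d1 / 2) (d2 / 2)).
have e0 : 0 < e by rewrite !lt_min t0 d0 !divr_gt0.
have xe : \forall k \near \oo, enorm (x k - xs) < e by have [N NP] := xsx e e0; exists N.
have [N _ NP] := filterI mk (filterI xe (xbx e e0)).
have {NP} [/andP[m0 mm] [xN xbN]] := NP N (leqnn N).
have := prox_grad_le m0 yb (xbP N).
move: xN xbN; rewrite !lt_min => /andP[/andP[xt xd] /andP[x1 x2]].
move=> /andP[/andP[xbt _] /andP[xb1 xb2]].
(* Lower semicontinuity: nonzero entries of [xs] and of [B *m xs] stay nonzero at nearby points. *)
have cle : card xs <= card (xb N).
  have tri := enormDB (xb N) (x N) xs; apply: card_le.
    by have := d1P (xb N); rewrite !mul1mx; apply; lra.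
  by apply: d2P; lra.
have := dP _ xd; move: xt xbt cle; rewrite -/v.
have yx : enorm (y - x N) <= a + enorm (x N - xs).
  by rewrite (enormB (x N)) enormDB.
have E1 : dotp (gradf (x N)) (y - x N) =
    dotp v (y - xs) + dotp (gradf (x N) - v) (y - x N) - dotp v (x N - xs).
  by rewrite !dotp_lin; ring.
have E2 : dotp (gradf (x N)) (xb N - x N) =
    dotp (gradf (x N) - v) (xb N - x N) + dotp v (xb N - x N).
  by rewrite !dotp_lin; ring.
rewrite E1 E2.
have k1 := dotp_le (gradf (x N) - v) (y - x N).
have k2 := dotp_ge v (x N - xs).
have k3 := dotp_ge (gradf (x N) - v) (xb N - x N).
have k4 := dotp_ge v (xb N - x N).
have sq1 : 0 <= m N / 2 * enorm (xb N - x N) ^+ 2.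
  by rewrite mulr_ge0 ?exprn_ge0 ?enorm_ge0 ?divr_ge0 ?(ltW m0).
have sq2 : m N / 2 * enorm (y - x N) ^+ 2 <= mhi / 2 * enorm (y - x N) ^+ 2.
  by rewrite ler_wpM2r ?exprn_ge0 ?enorm_ge0// ler_wpM2r.
have v0 := enorm_ge0 v; have a0 : 0 <= a := enorm_ge0 _.
have p0 := enorm_ge0 (x N - xs); have q0 := enorm_ge0 (y - x N).
have r0 := enorm_ge0 (xb N - x N); have w0 := enorm_ge0 (gradf (x N) - v).
rewrite -/a => xt xbt cle gt main.
have yt : enorm (y - x N) <= a + t by lra.
have sq3 : enorm (y - x N) ^+ 2 <= a ^+ 2 + t * (2 * a + 1).
  apply: (@le_trans _ _ ((a + t) ^+ 2)).
    by rewrite ler_pXn2r ?nnegrE// addr_ge0// ltW.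
  rewrite sqrrD; have := ler_wpM2l (ltW t0) t1; rewrite (expr2 t); lra.
have sq4 : mhi / 2 * enorm (y - x N) ^+ 2 <= mhi / 2 * (a ^+ 2 + t * (2 * a + 1)).
  by rewrite ler_wpM2l// divr_ge0// ltW.
have l1 : enorm (gradf (x N) - v) * enorm (y - x N) <= t * (a + 1).
  by rewrite ler_pM// ?ltW//; lra.
have l2 : enorm v * enorm (x N - xs) <= enorm v * t by rewrite ler_wpM2l// ltW.
have l3 : enorm (gradf (x N) - v) * enorm (xb N - x N) <= t * 1.
  by rewrite ler_pM// ?ltW//; lra.
have l4 : enorm v * enorm (xb N - x N) <= enorm v * t by rewrite ler_wpM2l// ltW.
by rewrite -/a; move: main cle; rewrite /card; lra.
Qed.

End Prox.

(** * Newton steps *)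

Section NewtonIterate.
Context {R : realType} {n : nat}.
Variables (f : 'cV[R]_n -> R) (g : 'cV[R]_n -> 'cV[R]_n) (H : 'cV[R]_n -> 'M[R]_n).
Variables (l u : 'cV[R]_n) (C : set 'cV[R]_n).
Variables (b1 sigma varsigma rho beta mlo mhi M L : R).
Hypotheses (C2 : C2_with f g H) (C_box : C `<=` box l u).
Hypothesis H_bound : forall z, box l u z -> forall v, enorm (H z *m v) <= L * enorm v.
Hypotheses (b1_gt0 : 0 < b1) (sigma_int : 0 < sigma < 1 / 2)
  (varsigma_gt : sigma < varsigma) (rho_int : 0 < rho < 1 / 2) (beta_int : 0 < beta < 1)
  (mlo_gt0 : 0 < mlo) (mhi_gt0 : 0 < mhi) (M_ge0 : 0 <= M) (L_gt0 : 0 < L).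

(* One Newton step from [x] to [xn]: [xb] is the proximal-gradient point, [m] the
   step parameter, [eta] the residual of the inexactly solved quadratic subproblem
   and [t] the number of backtracking steps. *)
Record newton_step (x xn xb y eta : 'cV[R]_n) (G : 'M[R]_n) (m : R) (t : nat) : Prop := {
  ns_x : C x;
  ns_y : C y;
  ns_next : xn = x + beta ^+ t *: (y - x);
  ns_armijo : f xn <= f x + rho * beta ^+ t * dotp (g x) (y - x);
  ns_backtrack : forall s, (s < t)%N ->
    ~ f (x + beta ^+ s *: (y - x)) <= f x + rho * beta ^+ s * dotp (g x) (y - x);
  ns_y_normal : normal_cone C y (eta - g x - G *m (y - x));
  ns_xb_normal : normal_cone C xb (m *: (x - xb) - g x);
  ns_m : mlo <= m <= mhi;
  ns_residual : x <> xb;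
  ns_eta : enorm eta <= 3 / 4 * enorm (m *: (x - xb));
  ns_eta_powR : enorm eta <= 3 / 4 * enorm (m *: (x - xb)) `^ (1 + varsigma);
  ns_G_quad : forall v, b1 * enorm (m *: (x - xb)) `^ sigma * enorm v ^+ 2 <= dotp (G *m v) v;
  ns_G_hess : forall v,
    b1 * enorm (m *: (x - xb)) `^ sigma * enorm v ^+ 2 <= dotp ((G - H x) *m v) v;
  ns_G_bound : forall v, enorm (G *m v) <= M * enorm v;
  ns_model : dotp (g x) (y - x) <= - (dotp (G *m (y - x)) (y - x) / 2) }.

(** Adding the two normal cone inequalities pairs the residual with [d] (coefficient 1), [eta] with
    [d] (3/4), and [G d] with [x - xb], whose norm is at most [N / mlo] (coefficient [M / mlo]). *)
Definition res_cst := 7 / 4 + M / mlo.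
(** The factor 4 undoes the quarter left after [eta] is absorbed, and [mhi] converts
    [enorm (x - xb)] into the residual norm. *)
Definition step_cst := 4 * mhi * res_cst.

Lemma res_cst_gt0 : 0 < res_cst.
Proof. by rewrite ltr_wpDr ?divr_gt0// divr_ge0// ltW. Qed.

Lemma step_cst_gt0 : 0 < step_cst.
Proof. by rewrite !mulr_gt0// res_cst_gt0. Qed.

Section OneStep.
Variables (x xn xb y eta : 'cV[R]_n) (G : 'M[R]_n) (m : R) (t : nat).
Hypothesis st : newton_step x xn xb y eta G m t.

Let d := y - x.
Let N := enorm (m *: (x - xb)).
Let e := b1 * N `^ sigma.

Lemma ns_m_gt0 : 0 < m.
Proof. by case/andP: (ns_m st) => /(lt_le_trans mlo_gt0). Qed.

Lemma ns_N_gt0 : 0 < N.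
Proof.
apply: enorm_gt0 => /eqP; rewrite scaler_eq0 gt_eqF ?ns_m_gt0//= subr_eq0 => /eqP.
exact: ns_residual st.
Qed.

Lemma ns_e_gt0 : 0 < e.
Proof. by rewrite mulr_gt0// powR_gt0// ns_N_gt0. Qed.

(* Monotonicity of the normal cone, applied to the optimality conditions of the
   proximal-gradient and of the Newton subproblem. *)
Lemma ns_monotone :
  dotp (G *m d) d + N * enorm (x - xb) / 4 <= res_cst * N * enorm d.
Proof.
have m0 := ns_m_gt0; have /andP[mm _] := ns_m st.
have [_ /(_ xb)] := ns_y_normal st; have [xbC /(_ y (ns_y st))] := ns_xb_normal st.
move=> h1 /(_ xbC) h2; have GM := ns_G_bound st d; have E := ns_eta st.
have NE : N = m * enorm (x - xb) by rewrite /N enormZ gtr0_norm.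
rewrite -/N in E; move: h1 h2; have -> : y - xb = d + (x - xb) by rewrite addrA subrK.
have -> : xb - y = - (d + (x - xb)) by rewrite -opprB addrA subrK.
rewrite -/d; move: (d) (x - xb) NE E GM => c a NE E GM; rewrite !dotp_lin => h1 h2.
have a0 := enorm_ge0 a; have d0 := enorm_ge0 c.
have k1 := dotp_ge (G *m c) a; have k2 := dotp_le eta c; have k3 := dotp_le eta a.
have k4 := dotp_ge a c.
have k5 := ler_wpM2r a0 GM; have k6 := ler_wpM2r d0 E; have k7 := ler_wpM2r a0 E.
have k8 : M * enorm c * enorm a <= M / mlo * N * enorm c.
  rewrite NE -[M * _ * _]mulrA -[M / mlo * _ * _]mulrA -[M / mlo * _]mulrA.
  rewrite ler_wpM2l// [leRHS]mulrC -mulrA [leLHS]mulrC.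
  rewrite [leRHS](_ : _ = (enorm a * enorm c) * (m / mlo)); last by ring.
  by rewrite ler_peMr ?mulr_ge0// ler_pdivlMr// mul1r.
have k9 := ler_wpM2l (ltW m0) k4.
have aa : dotp a a = enorm a ^+ 2 by rewrite enorm_sqr.
rewrite aa in h1 h2; rewrite /res_cst NE in k6 k7 k8 *; rewrite expr2 in h1 h2.
lra.
Qed.

Lemma ns_step_ge : N <= step_cst * enorm d.
Proof.
have N0 := ns_N_gt0; have /andP[_ mm] := ns_m st.
have NE : N = m * enorm (x - xb) by rewrite /N enormZ gtr0_norm// ns_m_gt0.
have Gd : 0 <= dotp (G *m d) d.
  apply: le_trans (ns_G_quad st d); rewrite mulr_ge0 ?exprn_ge0 ?enorm_ge0//.
  exact/ltW/ns_e_gt0.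
have : N * enorm (x - xb) <= N * (4 * res_cst * enorm d) by have := ns_monotone; lra.
rewrite ler_pM2l// => h; rewrite NE.
have := ler_wpM2l (ltW ns_m_gt0) h => /le_trans; apply.
have := ler_wpM2r (_ : 0 <= 4 * res_cst * enorm d) mm.
rewrite /step_cst !mulr_ge0 ?enorm_ge0 ?(ltW res_cst_gt0)// => /(_ isT); lra.
Qed.

Lemma ns_step_le : e * enorm d <= res_cst * N.
Proof.
have [d0|dn0] := eqVneq (enorm d) 0.
  by rewrite d0 mulr0 mulr_ge0 ?(ltW res_cst_gt0) ?(ltW ns_N_gt0).
have d0 : 0 < enorm d by rewrite lt0r dn0 enorm_ge0.
rewrite -(ler_pM2r d0) -mulrA -expr2.
have := ns_G_quad st d; have := ns_monotone; rewrite -/N -/e.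
have : 0 <= N * enorm (x - xb) by rewrite mulr_ge0 ?enorm_ge0.
lra.
Qed.

Lemma ns_d_gt0 : 0 < enorm d.
Proof.
by rewrite -(pmulr_rgt0 _ step_cst_gt0) (lt_le_trans ns_N_gt0 ns_step_ge).
Qed.

Lemma ns_dotp_neg : dotp (g x) d <= - (e * enorm d ^+ 2 / 2).
Proof. by have := ns_model st; have := ns_G_quad st d; rewrite -/N -/e -/d; lra. Qed.

Lemma ns_decrease : f xn <= f x - rho * beta ^+ t * (e * enorm d ^+ 2 / 2).
Proof.
apply: (le_trans (ns_armijo st)); rewrite lerD2l -mulrN.
rewrite ler_wpM2l ?ns_dotp_neg// mulr_ge0// ?exprn_ge0//.
  by case/andP: rho_int => /ltW.
by case/andP: beta_int => /ltW.
Qed.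

Lemma ns_strict_decrease : f xn < f x.
Proof.
apply: (le_lt_trans ns_decrease); rewrite gtrBl.
have /andP[r0 _] := rho_int; have /andP[be0 _] := beta_int.
by rewrite mulr_gt0 ?divr_gt0// mulr_gt0 ?ns_e_gt0// exprn_gt0 ?ns_d_gt0.
Qed.

Lemma segment_box (s : R) : 0 <= s <= 1 -> box l u (x + s *: d).
Proof.
by move=> s01; apply: box_convex => //; apply: C_box; [exact: ns_x st|exact: ns_y st].
Qed.

(** If backtracking occurred, the previous trial [a] was rejected; against the Taylor bound with
    Hessian norm [L] this forces [L a >= (1 - rho) e], and [beta ^+ t] is [beta a]. *)
Lemma ns_steplength : Num.min 1 (beta * (1 - rho) * e / L) <= beta ^+ t.
Proof.
case E : t => [|s]; first by rewrite expr0 ge_min lexx.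
have /andP[be0 be1] := beta_int; have /andP[r0 r1] := rho_int.
rewrite ge_min exprS; apply/orP; right.
have -> : beta * (1 - rho) * e / L = beta * ((1 - rho) * e / L) by ring.
rewrite ler_pM2l//.
have := ns_backtrack st (s := s); rewrite E ltnSn => /(_ isT)/negP.
rewrite -ltNge; set a := beta ^+ s => H1.
have a0 : 0 < a by rewrite exprn_gt0.
have a1 : a <= 1 by rewrite exprn_ile1// ltW.
have := second_order_le (x := x) (v := a *: d) (M := L * (a * enorm d) ^+ 2) C2.
move=> /(_ _) taylor; have {}taylor : f (x + a *: d) <=
    f x + a * dotp (g x) d + L * (a * enorm d) ^+ 2 / 2.
  rewrite -dotpZr; apply: taylor => s' /andP[s'0 s'1].
  apply: (le_trans (dotp_le _ _)); rewrite scalerA.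
  have Hb : box l u (x + (s' * a) *: d).
    apply: segment_box.
    by rewrite mulr_ge0 ?(ltW s'0) ?(ltW a0)//= mulr_ile1 ?(ltW s'0) ?(ltW a0) ?(ltW s'1).
  have aN : enorm (a *: d) = a * enorm d by rewrite enormZ gtr0_norm.
  by have := ler_wpM2r (enorm_ge0 (a *: d)) (H_bound Hb (a *: d)); rewrite aN -mulrA -expr2.
have d2 : 0 < enorm d ^+ 2 by rewrite exprn_gt0 ?ns_d_gt0.
rewrite -/d in H1; rewrite ler_pdivrMr//.
have h : 0 < a * ((1 - rho) * dotp (g x) d + L * a * enorm d ^+ 2 / 2).
  by rewrite exprMn in taylor; rewrite (expr2 a) in taylor; lra.
rewrite pmulr_rgt0// in h.
have r1' : 0 <= 1 - rho by lra.
have := ler_wpM2l r1' ns_dotp_neg => k.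
rewrite -(ler_pM2r d2); lra.
Qed.

(* With second-order Lipschitz control along the step, the error of the Newton
   model is dominated by the regularization [e] once the residual is small. *)
Lemma ns_unit_step (L' : R) : 0 <= L' ->
  (forall s, 0 < s < 1 -> dotp (H (x + s *: d) *m d) d <=
     dotp (H x *m d) d + L' * enorm d ^+ 3) ->
  3 / 4 * step_cst * N `^ (varsigma - sigma) +
    L' / 2 * (res_cst / b1) * N `^ (1 - 2 * sigma) <= b1 / 2 -> t = 0%N.
Proof.
move=> L'0 HL small; case E : t => [//|s].
have := ns_backtrack st (s := 0%N); rewrite E => /(_ isT); rewrite expr0 scale1r mulr1.
case; rewrite -/d; have N0 := ns_N_gt0.
have /andP[r0 r1] := rho_int.
have dd := ns_d_gt0.
have taylor := second_order_le C2 HL.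
have Ns : 0 < N `^ sigma by rewrite powR_gt0.
have NP p q : N `^ (p + q) = N `^ p * N `^ q by apply: powRD; rewrite (gt_eqF N0) implybT.
have NP1 q : N `^ (1 + q) = N * N `^ q by rewrite NP powRr1// ltW.
(* Exponents are split so that each error becomes [N ^ sigma * enorm d], the scale of the
   regularization, times a power of [N] that is positive because [sigma < varsigma] and
   [sigma < 1 / 2]. *)
have E1 : N `^ (1 + varsigma) = N * (N `^ sigma * N `^ (varsigma - sigma)).
  by rewrite -NP NP1; congr (_ * _ `^ _); ring.
have E2 : N = N `^ sigma * (N `^ sigma * N `^ (1 - 2 * sigma)).
  rewrite -!NP -[LHS]powRr1 ?ltW//; congr (_ `^ _); ring.
have n1 : 0 <= N `^ (varsigma - sigma) by exact: powR_ge0.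
have n2 : 0 <= N `^ (1 - 2 * sigma) by exact: powR_ge0.
have etaB : enorm eta <= 3 / 4 * step_cst * N `^ (varsigma - sigma) * (N `^ sigma * enorm d).
  apply: (le_trans (ns_eta_powR st)); rewrite -/N E1.
  have := ler_wpM2r (mulr_ge0 (ltW Ns) n1) ns_step_ge; lra.
have dB : enorm d <= res_cst / b1 * (N `^ sigma * N `^ (1 - 2 * sigma)).
  have := ns_step_le; rewrite /e [X in _ <= _ * X]E2.
  rewrite [leLHS](_ : _ = N `^ sigma * (b1 * enorm d)); last by ring.
  rewrite [leRHS]mulrCA ler_pM2l// => h.
  rewrite -(ler_pM2l b1_gt0) (le_trans h)// le_eqVlt; apply/orP; left; apply/eqP.
  by field; rewrite gt_eqF.
have key : enorm eta + L' / 2 * enorm d ^+ 2 <= e / 2 * enorm d.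
  have := ler_wpM2r (mulr_ge0 (divr_ge0 L'0 (ler0n _ 2)) (ltW dd)) dB.
  have := ler_wpM2r (mulr_ge0 (ltW Ns) (ltW dd)) small.
  rewrite /e expr2; lra.
have := ler_wpM2r (ltW dd) key; rewrite -/d.
(* Tested at [x], the normality at [y] gives [<g, d> <= <eta, d> - <G d, d>], sharper than the bound
   from the model decrease. *)
have [_ /(_ x (ns_x st))] := ns_y_normal st.
have -> : x - y = - d by rewrite opprB.
rewrite -/d dotpNr !dotpBl oppr_le0.
have := ns_G_hess st d; have := ns_G_quad st d; rewrite -/N -/e mulmxBl dotpBl.
have := dotp_le eta d; move: taylor.
have e0 := ns_e_gt0; have dG0 : 0 <= dotp (G *m d) d.
  by apply: le_trans (ns_G_quad st d); rewrite mulr_ge0 ?exprn_ge0 ?enorm_ge0// ltW.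
(* Here [rho < 1 / 2] enters: [(1 - rho)] copies of [<G d, d>] are gained by the linear term and
   only one half is lost to the quadratic one. *)
have q : 0 <= (1 / 2 - rho) * dotp (G *m d) d by rewrite mulr_ge0//; lra.
have eta0 : 0 <= rho * (enorm eta * enorm d).
  by rewrite !mulr_ge0 ?enorm_ge0// ltW.
move: q eta0; rewrite exprSr (expr2 (enorm d)).
move: (dotp (G *m d) d) (dotp (H x *m d) d) (dotp (g x) d) (dotp eta d) => Gd Hd gd ed.
move=> q eta0 h1 h2 h3 h4 h5 h6.
have r1' : 0 <= 1 - rho by lra.
have h7 : (1 - rho) * gd <= (1 - rho) * (enorm eta * enorm d - Gd).
  by rewrite ler_wpM2l//; lra.
lra.
Qed.

End OneStep.
End NewtonIterate.

(** * Asymptotics of the Newton iterates near an accumulation point *)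

Section NewtonSequence.
Context {R : realType} {n p : nat}.
Variables (f : 'cV[R]_n -> R) (g : 'cV[R]_n -> 'cV[R]_n) (H : 'cV[R]_n -> 'M[R]_n).
Variables (B : 'M[R]_(p, n)) (l u z0 : 'cV[R]_n).
Variables (b1 sigma varsigma rho beta mlo mhi M L : R).
Let C := PiSet B l u z0.
Hypothesis C2 : C2_with f g H.
Hypothesis H_bound : forall z, box l u z -> forall v, enorm (H z *m v) <= L * enorm v.
Hypotheses (b1_gt0 : 0 < b1) (sigma_int : 0 < sigma < 1 / 2)
  (varsigma_gt : sigma < varsigma) (rho_int : 0 < rho < 1 / 2) (beta_int : 0 < beta < 1)
  (mlo_gt0 : 0 < mlo) (mhi_gt0 : 0 < mhi) (M_ge0 : 0 <= M) (L_gt0 : 0 < L).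
Variables (x xb y eta : nat -> 'cV[R]_n) (G : nat -> 'M[R]_n) (m : nat -> R)
  (tt : nat -> nat) (K : nat).
Hypothesis steps : forall k, (K <= k)%N ->
  newton_step f g H C b1 sigma varsigma rho beta mlo mhi M
    (x k) (x k.+1) (xb k) (y k) (eta k) (G k) (m k) (tt k).
Variable xs : 'cV[R]_n.
Hypothesis xs_acc : accum_points x xs.

Let C_box : C `<=` box l u.
Proof. by move=> z; exact: PiSet_box. Qed.

Let N k := enorm (m k *: (x k - xb k)).
Let rc := res_cst mlo M.
Let sc := step_cst mlo mhi M.

Lemma powR_small (q e : R) : 0 < q -> 0 < e ->
  exists2 d : R, 0 < d & forall s, 0 <= s -> s < d -> s `^ q < e.
Proof.
move=> q0 e0; exists (e `^ q^-1) => [|s s0 sd]; first exact: powR_gt0.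
have -> : e = (e `^ q^-1) `^ q by rewrite -powRrM mulVf ?gt_eqF// powRr1// ltW.
by apply: gt0_ltr_powR => //; rewrite nnegrE// powR_ge0.
Qed.

(** Continuity at [xs] gives the weak inequality and one further strict decrease the strict one.
    Strictness is required to apply the Kurdyka-Lojasiewicz inequality. *)
Lemma values_gt_limit k : (K <= k)%N -> f xs < f (x k).
Proof.
have dec i : (K <= i)%N -> f (x i.+1) < f (x i).
  by move=> Ki; exact: ns_strict_decrease (steps Ki).
have ge i : (K <= i)%N -> f xs <= f (x i).
  move=> Ki; apply/ler_addgt0Pr => e e0; have [fg _] := C2.
  have [d d0 dP] := fun_continuous xs fg e0; have [j [ij /dP]] := xs_acc d0 i.
  have : f (x j) <= f (x i).
    rewrite -(subnK ij) addnC; elim: (j - i)%N => [|j' IH]; first by rewrite addn0.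
    by rewrite addnS (le_trans _ IH)// ltW// dec// (leq_trans Ki)// leq_addr.
  by rewrite ltr_norml => ? /andP[? _]; lra.
by move=> Kk; apply: le_lt_trans (dec k Kk); apply: ge; exact: leqW.
Qed.

Lemma values_cvg (c : R) : 0 < c -> \forall k \near \oo, f (x k) - f xs < c.
Proof.
move=> c0; have [fg _] := C2; have [d d0 dP] := fun_continuous xs fg c0.
have [j [Kj /dP]] := xs_acc d0 K; rewrite ltr_norml => /andP[_ fj].
exists j => // k /= jk; apply: le_lt_trans fj; rewrite lerD2r.
rewrite -(subnK jk) addnC; elim: (k - j)%N => [|i IH]; first by rewrite addn0.
rewrite addnS (le_trans _ IH)// ltW//; apply: ns_strict_decrease (steps _) => //.
by rewrite (leq_trans Kj)// leq_addr.
Qed.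

(** A residual of at least [d] bounds [e_k], the step length and the direction from below, hence
    forces a drop of at least [c]; late values lie less than [c] above [f xs] and stay above it. *)
Lemma residual_cvg0 (d : R) : 0 < d -> \forall k \near \oo, N k < d.
Proof.
move=> d0; pose e0 := b1 * d `^ sigma; have e0_gt0 : 0 < e0 by rewrite mulr_gt0// powR_gt0.
have /andP[r0 r1] := rho_int; have /andP[be0 be1] := beta_int; have /andP[s0 _] := sigma_int.
pose a0 := Num.min 1 (beta * (1 - rho) * e0 / L).
have a0_gt0 : 0 < a0.
  rewrite lt_min ltr01 divr_gt0// mulr_gt0// mulr_gt0//; lra.
have sc0 : 0 < sc by exact: step_cst_gt0.
pose c := rho * a0 * (e0 * (d / sc) ^+ 2 / 2).
have c0 : 0 < c.
  rewrite mulr_gt0//; first by rewrite mulr_gt0.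
  by rewrite divr_gt0// mulr_gt0// exprn_gt0// divr_gt0.
apply: filterS2 (nbhs_infty_ge K) (values_cvg c0) => k Kk fc.
rewrite ltNge; apply/negP => dN.
have := ns_decrease rho_int beta_int (steps Kk).
have fk := values_gt_limit (leqW Kk); rewrite leNgt => /negP; apply.
rewrite ltrBlDr; apply: (@lt_le_trans _ _ (f (x k.+1) + c)); first by lra.
rewrite lerD2l /c.
have ee : e0 <= b1 * N k `^ sigma.
  rewrite ler_pM2l//; apply: ge0_ler_powR => //; rewrite ?nnegrE ?enorm_ge0 ?ltW//.
have aa : a0 <= beta ^+ tt k.
  apply: le_trans (ns_steplength C2 C_box H_bound b1_gt0 rho_int beta_int
    mlo_gt0 mhi_gt0 M_ge0 L_gt0 (steps Kk)).
  rewrite /a0 le_min ge_min lexx/= ge_min; apply/orP; right.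
  rewrite ler_pM2r ?invr_gt0// ler_pM2l// mulr_gt0//; lra.
have dd : d / sc <= enorm (y k - x k).
  rewrite ler_pdivrMr// mulrC; apply: (le_trans dN).
  exact: (ns_step_ge b1_gt0 mlo_gt0 M_ge0 (steps Kk)).
have dsc : 0 <= d / sc by rewrite ltW// divr_gt0.
rewrite ler_pM//.
- by rewrite mulr_ge0// ltW.
- by rewrite divr_ge0// mulr_ge0 ?exprn_ge0// ltW.
- by rewrite ler_wpM2l// ltW.
- rewrite ler_wpM2r ?invr_ge0// ler_pM ?exprn_ge0 ?(ltW e0_gt0)//.
  by rewrite ler_pXn2r ?nnegrE ?enorm_ge0.
Qed.

Lemma direction_cvg0 (d : R) : 0 < d -> \forall k \near \oo, enorm (y k - x k) < d.
Proof.
move=> d0; have rc0 : 0 < rc by exact: res_cst_gt0.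
have /andP[s0 s1] := sigma_int.
have q0 : 0 < 1 - sigma by lra.
have [h h0 hP] := powR_small q0 (mulr_gt0 d0 (divr_gt0 b1_gt0 rc0)).
apply: filterS2 (nbhs_infty_ge K) (residual_cvg0 h0) => k Kk /hP.
move=> /(_ (enorm_ge0 _)) Nq.
have N0 : 0 < N k by exact: (ns_N_gt0 mlo_gt0 (steps Kk)).
have Ns : 0 < N k `^ sigma by rewrite powR_gt0.
have := ns_step_le mlo_gt0 M_ge0 (steps Kk).
rewrite -/(N k) -/rc.
(* Cancelling [N k ^ sigma] in the step bound leaves [enorm d] at most a multiple of
   [N k ^ (1 - sigma)]. *)
have NE : N k = N k `^ sigma * N k `^ (1 - sigma).
  rewrite -powRD ?(gt_eqF N0) ?implybT//.
  by rewrite (_ : sigma + (1 - sigma) = 1) ?powRr1 ?ltW//; ring.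
rewrite [X in _ <= _ * X]NE [leLHS](_ : _ = N k `^ sigma * (b1 * enorm (y k - x k))); last by ring.
rewrite [leRHS]mulrCA ler_pM2l// => h1.
rewrite -(ltr_pM2l b1_gt0) (le_lt_trans h1)//.
have -> : b1 * d = rc * (d * (b1 / rc)) by field; rewrite gt_eqF.
by rewrite ltr_pM2l.
Qed.

Lemma step_le_direction k : (K <= k)%N -> enorm (x k.+1 - x k) <= enorm (y k - x k).
Proof.
move=> Kk; rewrite (ns_next (steps Kk)) addrC addKr enormZ.
have /andP[be0 be1] := beta_int.
by rewrite ger0_norm ?exprn_ge0 ?(ltW be0)// ler_piMl ?enorm_ge0// exprn_ile1// ltW.
Qed.

Lemma eventually_unit_step (Lz r : R) : 0 < r ->
  (forall v w, enorm (v - xs) < r -> enorm (w - xs) < r ->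
     fnorm (H v - H w) <= Lz * enorm (v - w)) ->
  exists2 r' : R, 0 < r' & \forall k \near \oo, enorm (x k - xs) < r' -> tt k = 0%N.
Proof.
move=> r0 HL; have /andP[s0 s1] := sigma_int.
have q1 : 0 < varsigma - sigma by rewrite subr_gt0.
have q2 : 0 < 1 - 2 * sigma by lra.
(* Each of the two error terms is to fall below [b1 / 4]; adding 1 to the coefficients keeps the
   divisors positive even if [Lz] is 0. *)
pose A1 := 3 / 4 * sc; pose A2 := `|Lz| / 2 * (rc / b1).
have A10 : 0 < A1 + 1 by rewrite ltr_wpDl// mulr_ge0// ltW// step_cst_gt0.
have A20 : 0 < A2 + 1.
  by rewrite ltr_wpDl// mulr_ge0// divr_ge0// ltW// res_cst_gt0.
have b4 : 0 < b1 / 4 by rewrite divr_gt0.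
have [h1 h10 h1P] := powR_small q1 (divr_gt0 b4 A10).
have [h2 h20 h2P] := powR_small q2 (divr_gt0 b4 A20).
have r2 : 0 < r / 2 by rewrite divr_gt0.
(* The other half of the radius is left for the direction, so the whole step stays where the Hessian
   is Lipschitz. *)
exists (r / 2) => //.
apply: filterS (filterI (nbhs_infty_ge K) (filterI (direction_cvg0 r2)
  (filterI (residual_cvg0 h10) (residual_cvg0 h20)))) => k [Kk [dk [N1 N2]]] xk.
apply: (ns_unit_step C2 b1_gt0 rho_int mlo_gt0 mhi_gt0 M_ge0 (steps Kk) (normr_ge0 Lz)).
- move=> s /andP[s'0 s'1]; rewrite -lerBlDl -dotpBl -mulmxBl.
  set d := y k - x k; have sd : enorm (s *: d) <= enorm d.
    by rewrite enormZ gtr0_norm// ler_piMl ?enorm_ge0 ?ltW.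
  have d0 := enorm_ge0 d.
  apply: (le_trans (dotp_le _ _)).
  rewrite (_ : `|Lz| * enorm d ^+ 3 = `|Lz| * enorm d * enorm d * enorm d); last by ring.
  rewrite ler_wpM2r//.
  have := enorm_mulmx (H (x k + s *: d) - H (x k)) d => /le_trans; apply.
  rewrite ler_wpM2r//.
  have x1 : enorm (x k + s *: d - xs) < r.
    rewrite addrAC; have := enormD (x k - xs) (s *: d).
    by move: dk xk; rewrite -/d; lra.
  have x2 : enorm (x k - xs) < r by lra.
  apply: (le_trans (HL _ _ x1 x2)); rewrite addrAC subrr add0r.
  by rewrite (le_trans (ler_wpM2r (enorm_ge0 _) (ler_norm Lz)))// ler_wpM2l.
- have := h1P _ (enorm_ge0 _) N1; have := h2P _ (enorm_ge0 _) N2.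
  rewrite !ltr_pdivlMr// -/sc -/rc /A1 /A2.
  have := powR_ge0 (N k) (varsigma - sigma); have := powR_ge0 (N k) (1 - 2 * sigma).
  rewrite /N; lra.
Qed.

(** The normal at [y k] differs from [- g xs] by the inexactness, a gradient difference and [G d],
    each below [h / 4], so the identification lemma applies at [y k]. *)
Lemma eventually_active_y : rel_int (normal_cone C xs) (- g xs) ->
  exists2 r : R, 0 < r & \forall k \near \oo, enorm (x k - xs) < r ->
    active l u (y k) = active l u xs.
Proof.
move=> gri; have [h h0 hP] := active_identification gri; have [_ [gH _]] := C2.
have h4 : 0 < h / 4 by rewrite divr_gt0.
have [r r0 rP] := grad_continuous_at xs gH h4.
have M1 : 0 < M + 1 by rewrite ltr_wpDl.
exists (Num.min r (h / 2)); first by rewrite lt_min r0 divr_gt0.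
apply: filterS (filterI (nbhs_infty_ge K) (filterI (direction_cvg0 h4)
  (filterI (direction_cvg0 (divr_gt0 h4 M1)) (residual_cvg0 h4)))) => k [Kk [dk [dk' Nk]]].
rewrite lt_min => /andP[/rP gx xk].
apply: hP (ns_y_normal (steps Kk)).
  by have := enormDB (y k) (x k) xs; lra.
rewrite opprK (_ : _ + g xs = eta k + (g xs - g (x k)) - G k *m (y k - x k)); last first.
  by rewrite addrAC -!addrA; congr (_ + _); rewrite addrCA [in RHS]addrA addrA.
have := ns_G_bound (steps Kk) (y k - x k); have := ns_eta (steps Kk).
have := enormD (eta k + (g xs - g (x k))) (- (G k *m (y k - x k))).
have := enormD (eta k) (g xs - g (x k)); rewrite enormN (enormB (g xs)) -/(N k).
move: dk'; rewrite ltr_pdivlMr//; have := enorm_ge0 (y k - x k); lra.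
Qed.

(** The face of [x k.+1] is known because [x k.+1 = y k] comes from a unit step, and the face of
    [y k.+1] by identification at the next index; both are the face of [xs]. *)
Lemma eventually_identified (Lz r : R) : 0 < r ->
  (forall v w, enorm (v - xs) < r -> enorm (w - xs) < r ->
     fnorm (H v - H w) <= Lz * enorm (v - w)) ->
  rel_int (normal_cone C xs) (- g xs) ->
  exists2 r' : R, 0 < r' & \forall k \near \oo, enorm (x k - xs) < r' ->
    x k.+1 = y k /\ active l u (x k) = active l u (y k).
Proof.
move=> r0 HL gri; have [r1 r10 U] := eventually_unit_step r0 HL.
have [r2 r20 A] := eventually_active_y gri.
have [h hE] : exists h : R, h = Num.min r1 r2 by exists (Num.min r1 r2).
have h0 : 0 < h / 2 by rewrite divr_gt0// hE lt_min r10.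
have [N0 _ N0P] := filterI (nbhs_infty_ge K) (filterI (direction_cvg0 h0) (filterI U A)).
have unit k : (N0 <= k)%N -> enorm (x k - xs) < h ->
    x k.+1 = y k /\ active l u (y k) = active l u xs.
  move=> Nk; have [Kk [_ [Uk Ak]]] := N0P k Nk; rewrite hE lt_min => /andP[/Uk t0 /Ak ->].
  by rewrite (ns_next (steps Kk)) t0 expr0 scale1r addrC subrK.
(* Starting one index later provides a predecessor; as its step is shorter than [h / 2], it lies
   within [h] of [xs] and the facts above hold for it too. *)
exists (h / 2) => //; exists N0.+1 => // -[//|k] /= Nk xk.
have [Kk [dk _]] := N0P k Nk.
have xh : enorm (x k.+1 - xs) < h.
  by apply: lt_trans xk _; move: h0; lra.
have [-> ay] := unit k.+1 (leqW Nk) xh; split=> //; rewrite ay.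
have [|E ak] := unit k Nk; last by rewrite E.
have := step_le_direction Kk; have := enormDB (x k) (x k.+1) xs.
by rewrite (enormB (x k) (x k.+1)); lra.
Qed.

Lemma eventual_descent (Lz r c : R) (xi : nat -> 'cV[R]_n) : 0 < r ->
  (forall v w, enorm (v - xs) < r -> enorm (w - xs) < r ->
     fnorm (H v - H w) <= Lz * enorm (v - w)) ->
  rel_int (normal_cone C xs) (- g xs) ->
  (\forall k \near \oo, normal_cone C (x k) (xi k)) ->
  (\forall k \near \oo, c * (enorm (g (x k) + xi k) * enorm (y k - x k)) <=
     - dotp (g (x k) + xi k) (y k - x k)) ->
  exists2 r' : R, 0 < r' & \forall k \near \oo, enorm (x k - xs) < r' ->
    rho * c * (enorm (g (x k) + xi k) * enorm (x k.+1 - x k)) <= f (x k) - f (x k.+1).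
Proof.
move=> r0 HL gri xiN ang; have [r' r'0 I] := eventually_identified r0 HL gri.
exists r' => //; apply: filterS (filterI (nbhs_infty_ge K) (filterI xiN
  (filterI ang I))) => k [Kk [xik [angk Ik]]] /Ik[xy act].
have Cy := ns_y (steps Kk).
(* The active bounds agree, so the normal moves from [x k] to [y k]; tested at [x k] it can then be
   added to the gradient in the Armijo inequality. *)
have : normal_cone C (y k) (xi k).
  apply: normal_cone_active (xik) => //; first exact: ns_x (steps Kk).
  by rewrite act /active_sub !fintype.subxx.
move=> [_ /(_ _ (ns_x (steps Kk)))]; rewrite -[x k - y k]opprB dotpNr oppr_le0 => xid.
have E : beta ^+ tt k *: (y k - x k) = y k - x k.
  by rewrite -[in RHS]xy (ns_next (steps Kk)) [RHS]addrC addKr.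
have := ns_armijo (steps Kk); rewrite -mulrA -dotpZr E xy => fk.
have /andP[rho0 _] := rho_int.
move: angk; rewrite dotpDl => angk.
have : rho * (c * (enorm (g (x k) + xi k) * enorm (y k - x k))) <=
   rho * - dotp (g (x k)) (y k - x k) by rewrite ler_pM2l//; lra.
lra.
Qed.

End NewtonSequence.

(** * The Kurdyka-Lojasiewicz argument *)

Section KurdykaLojasiewicz.
Context {R : realType}.
Variables (eta : \bar R) (phi : R -> R).
Hypothesis ups : Upsilon eta phi.

(** The tangent inequality. Difference quotients at [s] are taken with increments [- (a * (s - t))]
    towards [t], so differentiability is used at [s] only and [t = 0] is allowed. *)
Lemma Upsilon_concave (s t : R) : 0 < s -> (s%:E < eta)%E -> 0 <= t <= s ->
  derive1 phi s * (s - t) <= phi s - phi t.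
Proof.
move=> s0 seta /andP[t0 ts]; have [_ [conc [_ [der _]]]] := ups.
have [->|tns] := eqVneq t s; first by rewrite !subrr mulr0.
have st : 0 < s - t by rewrite subr_gt0 lt_neqAle tns.
have teta : (t%:E < eta)%E by rewrite (le_lt_trans _ seta)// lee_fin.
have ds := der s (conj s0 seta).
rewrite -subr_le0.
apply: (@le0_small_multiples _ _ (s - t)) => e /andP[e0 _].
have /cvgrPdist_le/(_ e e0) : h^-1 *: ((phi \o shift s) (h *: (1 : R)) - phi s)
    @[h --> 0^'] --> derive1 phi s by rewrite derive1E; exact: ds.
move=> /nbhs_ballP[d /= d0 dP].
pose a := Num.min 1 (d / 2 / (s - t)).
have a0 : 0 < a by rewrite lt_min ltr01 !divr_gt0.
have a1 : a <= 1 by rewrite ge_min lexx.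
have ad : a * (s - t) < d.
  apply: (@le_lt_trans _ _ (d / 2)); last by rewrite gtr_pMr// invf_lt1// ltr1n.
  by rewrite -ler_pdivlMr// ge_min lexx orbT.
have hn : 0 < a * (s - t) by rewrite mulr_gt0.
have := dP (- (a * (s - t))); rewrite /ball/= sub0r opprK gtr0_norm// => /(_ ad).
rewrite oppr_eq0 gt_eqF// => /(_ isT).
have -> : (- (a * (s - t))) *: 1 + s = a * t + (1 - a) * s.
  by rewrite [_ *: 1]mulr1; ring.
have := conc t s a (conj t0 teta) (conj (ltW s0) seta); rewrite (ltW a0) a1 => /(_ isT).
set P := phi (_ + _) => c1; rewrite ler_norml => /andP[_].
rewrite [_ *: _]mulrC invrN mulrN opprK => c2.
have c3 : derive1 phi s * (a * (s - t)) + (P - phi s) <= e * (a * (s - t)).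
  by rewrite -[P - _](divfK (lt0r_neq0 hn)) -mulrDl ler_pM2r.
rewrite -(ler_pM2l a0); lra.
Qed.

Lemma Upsilon_small (e : R) : (0 < eta)%E -> 0 < e -> exists2 d : R, 0 < d &
  forall s, 0 <= s -> s < d -> ((s%:E < eta)%E) /\ (phi s < e).
Proof.
move=> eta0 e0; have [cont [_ [_ [_ [_ [phi0 _]]]]]] := ups.
have [d1 d10 d1P] : exists2 d : R, 0 < d & forall s, s < d -> (s%:E < eta)%E.
  case: (eta) eta0 => [r r0||//]; first by exists r; rewrite ?lte_fin// => s; rewrite lte_fin.
  by move=> _; exists 1 => // s _; rewrite ltry.
have := (subspace_continuousP _ _).1 cont 0 (conj (lexx 0) eta0).
move=> /cvgrPdist_lt/(_ e e0)/nbhs_ballP[d2 /= d20 d2P].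
exists (Num.min d1 d2) => [|s s0]; first by rewrite lt_min d10.
rewrite lt_min => /andP[/d1P seta sd]; split=> //.
have sb : ball (0 : R) d2 s by rewrite /ball/= sub0r normrN ger0_norm.
have : `|phi 0 - phi s| < e by exact: (d2P s sb (conj s0 seta)).
by rewrite phi0 sub0r normrN => /(le_lt_trans (ler_norm _)).
Qed.

Context {n : nat}.
Variables (x : nat -> 'cV[R]_n) (xs : 'cV[R]_n) (s D : nat -> R) (c r : R).
Hypotheses (eta_gt0 : (0 < eta)%E) (c_gt0 : 0 < c) (r_gt0 : 0 < r).
Hypotheses (xs_acc : accum_points x xs) (s_gt0 : \forall k \near \oo, 0 < s k)
  (s_cvg0 : forall e : R, 0 < e -> \forall k \near \oo, s k < e).
Hypothesis KL : \forall k \near \oo, enorm (x k - xs) < r -> ((s k)%:E < eta)%E ->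
  1 <= derive1 phi (s k) * D k.
Hypothesis descent : \forall k \near \oo, enorm (x k - xs) < r ->
  c * (D k * enorm (x k.+1 - x k)) <= s k - s k.+1.

(** With [s] the gap in values and [D] the subgradient norm: the step length is at most [phi' D]
    times itself, the descent replaces [D] times the step by the drop of [s], and concavity replaces
    [phi'] times that drop by the drop of [phi]. *)
Lemma KL_one_step : \forall k \near \oo, enorm (x k - xs) < r -> ((s k)%:E < eta)%E ->
  0 < s k.+1 -> c * enorm (x k.+1 - x k) <= phi (s k) - phi (s k.+1).
Proof.
have [_ [_ [_ [_ [_ [_ dpos]]]]]] := ups.
apply: filterS (filterI KL (filterI descent s_gt0)) => k [KLk [dk sk]] xk seta sk1.
have dp := dpos _ (conj sk seta); have k1 := KLk xk seta; have k2 := dk xk.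
have D0 : 0 < D k by rewrite -(pmulr_rgt0 _ dp) (lt_le_trans _ k1).
have D2 : 0 <= c * (D k * enorm (x k.+1 - x k)) by rewrite !mulr_ge0 ?enorm_ge0// ltW.
have := @Upsilon_concave (s k) (s k.+1) sk seta.
rewrite (ltW sk1) -subr_ge0 (le_trans D2 k2) => /(_ isT); apply: le_trans.
have := ler_wpM2l (ltW dp) k2; apply: le_trans.
have cx : 0 <= c * enorm (x k.+1 - x k) by rewrite mulr_ge0 ?enorm_ge0// ltW.
have := ler_wpM2r cx k1; rewrite mul1r => /le_trans; apply.
by rewrite le_eqVlt; apply/orP; left; apply/eqP; ring.
Qed.

(* The desingularized values bound the path length, so an iterate entering a small
   ball with a small value never leaves it. *)
Lemma KL_trapped (r' : R) : 0 < r' -> r' <= r -> exists k0, forall j,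
  enorm (x (j + k0)%N - xs) < r' /\
  \sum_(0 <= i < j) enorm (x (i + k0).+1 - x (i + k0)%N) <= r'.
Proof.
move=> r'0 r'r; have r2 : 0 < r' / 2 by rewrite divr_gt0.
(* Half of [r'] is spent on the distance of the starting iterate, half on the path length, which
   telescopes to at most [phi (s k0) / c]. *)
have [d d0 dP] := Upsilon_small eta_gt0 (mulr_gt0 c_gt0 r2).
have [N _ NP] := filterI KL_one_step (filterI s_gt0 (s_cvg0 d0)).
have [_ [_ [phige _]]] := ups.
have [k0 [Nk0 xk0]] := xs_acc r2 N; exists k0.
have Nj j : (N <= j + k0)%N by rewrite (leq_trans Nk0)// leq_addl.
have sj j : 0 < s (j + k0)%N /\ ((s (j + k0)%N)%:E < eta)%E.
  by have [_ [sj0 sjd]] := NP _ (Nj j); split=> //; have [] := dP _ (ltW sj0) sjd.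
have [_ phik0] : ((s k0)%:E < eta)%E /\ phi (s k0) < c * (r' / 2).
  by have [_ [s0 sd]] := NP _ Nk0; exact: dP (ltW s0) sd.
pose S j := \sum_(0 <= i < j) enorm (x (i + k0).+1 - x (i + k0)%N).
suff main j : enorm (x (j + k0)%N - xs) <= enorm (x k0 - xs) + S j /\
    c * S j <= phi (s k0) - phi (s (j + k0)%N).
  move=> j; have [m1 m2] := main j; have [s1 s2] := sj j.
  have pj := phige _ (conj (ltW s1) s2).
  have Sj : S j < r' / 2 by rewrite -(ltr_pM2l c_gt0); lra.
  by split; rewrite -?/(S j); lra.
elim: j => [|j [m1 m2]]; first by rewrite /S big_geq// mulr0 subrr addr0.
have [s1 s2] := sj j; have [s3 s4] := sj j.+1.
have pj := phige _ (conj (ltW s1) s2).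
have Sj : S j < r' / 2 by rewrite -(ltr_pM2l c_gt0); lra.
have xj : enorm (x (j + k0)%N - xs) < r by lra.
have [step _] := NP _ (Nj j).
have {}step := step xj s2 s3.
rewrite /S big_nat_recr//= -/(S j) !addSn mulrDr; split; last by lra.
by have := enormDB (x (j + k0).+1) (x (j + k0)%N) xs; lra.
Qed.

Lemma KL_vconv : vconv x xs.
Proof.
move=> e e0; have [||k0 k0P] := @KL_trapped (Num.min e r).
- by rewrite lt_min e0.
- by rewrite ge_min lexx orbT.
exists k0 => k k0k; rewrite -(subnK k0k); have [+ _] := k0P (k - k0)%N.
by rewrite lt_min => /andP[].
Qed.

Lemma KL_summable : (\sum_(1 <= k <oo) (enorm (x k.+1 - x k))%:E < +oo)%E.
Proof.
have [k0 k0P] := KL_trapped r_gt0 (lexx r).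
pose a k := enorm (x k.+1 - x k); have a0 k : 0 <= a k by exact: enorm_ge0.
apply: (@le_lt_trans _ _ (\sum_(0 <= k < k0) a k + r)%:E); last exact: ltry.
apply: lime_le.
  by apply: is_cvg_nneseries => k _ _; rewrite lee_fin enorm_ge0.
apply: nearW => k; rewrite sumEFin lee_fin.
(* Enlarging the range to [[0, k + k0)] lets it be cut at [k0], whether or not [k] has passed
   [k0]. *)
apply: (@le_trans _ _ (\sum_(0 <= i < k + k0) a i)).
  have S0 i j : 0 <= \sum_(i <= k < j) a k by apply: sumr_ge0 => ? _; exact: a0.
  case: k => [|k]; first by rewrite big_geq.
  rewrite (@big_cat_nat _ _ _ k.+1 0 (k.+1 + k0))//= ?leq_addr//.
  rewrite [X in _ <= X + _]big_ltn// -addrA addrCA lerDl.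
  by rewrite addr_ge0 ?S0 ?a0.
rewrite (@big_cat_nat _ _ _ k0 0 (k + k0))//= ?leq_addl// lerD2l.
by rewrite -{1}[k0]add0n big_addn addnK; have [] := k0P k.
Qed.

End KurdykaLojasiewicz.

(** Some tail infimum is positive; it is finite because it lies below finite terms, so it serves as
    the real constant [c]. *)
Lemma limn_einf_gt0 {R : realType} (a : nat -> R) : (0 < limn_einf (fun k => (a k)%:E))%E ->
  exists2 c : R, 0 < c & \forall k \near \oo, c <= a k.
Proof.
rewrite limn_einf_lim => h.
have [N hN] : exists N, (0 < einfs (fun k => (a k)%:E) N)%E.
  apply: contrapT => /forallNP H; move: h; apply/negP; rewrite -leNgt.
  apply: lime_le; first exact: is_cvg_einfs.
  by apply: nearW => N; rewrite leNgt; apply/negP/H.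
have lb k : (N <= k)%N -> (einfs (fun k => (a k)%:E) N <= (a k)%:E)%E.
  by move=> Nk; apply: ereal_inf_lbound; exists k.
case E : (einfs (fun k => (a k)%:E) N) hN lb => [c||//] c0 lb.
- by exists c => //; exists N => // k /lb; rewrite lee_fin.
- by have := lb N (leqnn N); rewrite leye_eq.
Qed.

(** * Runs of the algorithm *)

Section Run.
Context {R : realType} {n p : nat}.
Variables (B : 'M[R]_(p, n)) (lam1 lam2 : R) (l u : 'cV[R]_n) (f : 'cV[R]_n -> R)
  (gradf : 'cV[R]_n -> 'cV[R]_n) (hessf : 'cV[R]_n -> 'M[R]_n).
Variables (mumin mumax tau alpha b1 b2 rho sigma varsigma beta : R).
Variables (x xbar y d : nat -> 'cV[R]_n) (mu mubar : nat -> R) (mm tt : nat -> nat)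
  (G : nat -> 'M[R]_n).
Hypotheses (lam1_gt0 : 0 < lam1) (lam2_gt0 : 0 < lam2)
  (box0 : box l u 0) (C2 : C2_with f gradf hessf).
Hypotheses (mumin_gt0 : 0 < mumin) (tau_gt1 : 1 < tau) (alpha_gt0 : 0 < alpha)
  (b1_gt0 : 0 < b1) (sigma_gt0 : 0 < sigma) (beta_int : 0 < beta < 1).
Hypothesis run : PGiPN_run B lam1 lam2 l u f gradf mumin mumax tau alpha rho varsigma beta
  x xbar y d mu mubar mm tt G.

Let newton k := (supp (x k) == supp (xbar k)) && (supp (B *m x k) == supp (B *m xbar k)).

Lemma indic_plus_le (C : set 'cV[R]_n) q z w : C z ->
  (indic_plus C q w <= indic_plus C q z)%E -> C w /\ q w <= q z.
Proof.
move=> Cz; rewrite /indic_plus (mem_set Cz); case: ifPn => [|_]; last by rewrite leye_eq.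
by rewrite in_setE lee_fin.
Qed.

Lemma run_prox k : prox_inv (mubar k) (gfun B lam1 lam2 l u)
  (x k - (mubar k)^-1 *: gradf (x k)) (xbar k).
Proof. by have [_ /(_ k)[_ [zP _] _ -> _]] := run. Qed.

Lemma run_xbar_box k : box l u (xbar k).
Proof. exact: prox_box box0 (run_prox k). Qed.

Lemma run_box k : box l u (x k).
Proof.
elim: k => [|k IH]; first by have [] := run.
have [_ /(_ k)[_ _ _ _]] := run; case: ifP => [_ [Th _ dE _ ->]|_ ->]; last first.
  exact: run_xbar_box.
have [/PiSet_box yb _] := indic_plus_le (PiSet_self _ IH) Th.
have /andP[be0 be1] := beta_int.
by rewrite dE; apply: box_convex => //; rewrite exprn_ge0 ?exprn_ile1// ltW.
Qed.

(** A failed support test would set [x k.+1 = xbar k]; equal sets [PiSet] then give [xbar k] the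
    supports of [x k], so the test could not have failed. *)
Lemma run_eventually_newton K :
  (forall k, (K <= k)%N -> PiSet B l u (x k) = PiSet B l u (x K)) ->
  forall k, (K <= k)%N -> newton k.
Proof.
move=> PK k Kk; have [_ /(_ k)[_ _ _ _]] := run; rewrite -/(newton k); case: ifP => // nk xS.
have E : PiSet B l u (x k) = PiSet B l u (x k.+1).
  by rewrite (PK k Kk) (PK k.+1 (leqW Kk)).
have [] := PiSet_inj (run_box k) (run_box k.+1) E.
by rewrite xS => s1 s2; move: nk; rewrite /newton s1 s2 !eqxx.
Qed.

Lemma run_direction K :
  (forall k, (K <= k)%N -> PiSet B l u (x k) = PiSet B l u (x K)) ->
  forall k, (K <= k)%N -> d k = y k - x k.
Proof.
move=> PK k Kk; have nk := run_eventually_newton PK Kk.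
by have [_ /(_ k)[_ _ _ _]] := run; rewrite -/(newton k) nk => -[].
Qed.

(** A trial parameter of at least [L + alpha] is never rejected, since a proximal point exists and
    satisfies the decrease test. The last rejected one is thus below [L + alpha], and acceptance
    costs one more factor [tau]. *)
Lemma run_mubar_bounds : exists2 mhi : R, 0 < mhi & forall k, mumin <= mubar k <= mhi.
Proof.
have [L L0 HL] := hessian_bounded C2 l u.
have tau0 : 0 < tau by exact: lt_trans ltr01 tau_gt1.
have [mu0min mu0max] : mumin <= mu 0%N /\ mu 0%N <= mumax.
  by have [_ /(_ 0%N)[/andP[]]] := run.
have mumax0 : 0 < mumax by rewrite (lt_le_trans mumin_gt0)// (le_trans mu0min).
have tL : 0 < tau * (L + alpha) by rewrite mulr_gt0// addr_gt0.
exists (mumax + tau * (L + alpha)) => [|k]; first by rewrite addr_gt0.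
have [_ /(_ k)[/andP[mlo mhi] _ noPG -> _]] := run.
have mu0 : 0 < mu k by exact: lt_le_trans mlo.
have tk j : 1 <= tau ^+ j by rewrite exprn_ege1// ltW.
apply/andP; split.
  by rewrite (le_trans mlo)// ler_peMr// ltW.
case E : (mm k) => [|j]; first by rewrite expr0 mulr1 (le_trans mhi)// lerDl ltW.
have [muL|muL] := leP (L + alpha) (mu k * tau ^+ j); last first.
  apply: (@le_trans _ _ (tau * (L + alpha))); last by rewrite lerDr ltW.
  by rewrite exprS mulrCA ler_pM2l// ltW.
have muj : 0 < mu k * tau ^+ j by rewrite mulr_gt0// exprn_gt0.
have [z zP] := prox_exists B lam1_gt0 lam2_gt0
  (x k - (mu k * tau ^+ j)^-1 *: gradf (x k)) muj box0.
exfalso; apply: (noPG j); first by rewrite E.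
exists z; split=> //.
exact: (prox_sufficient_decrease C2 HL muj muL (run_box k) zP).
Qed.

(** Iterates and proximal points stay in the box; this makes the bound [M + e k] on [G k] uniform in
    [k]. *)
Lemma run_ek_bounded : exists2 E : R, 0 <= E &
  forall k, ek b1 sigma x xbar mubar k <= E.
Proof.
have [D D0 DP] : exists2 D : R, 0 < D & forall z, box l u z -> enorm z <= D.
  apply: (locally_bounded_box (Q := fun z M => enorm z <= M)).
    by move=> z M M' MM' /le_trans; exact.
  move=> z _; exists 1, (enorm z + 1); split=> // w _ wz.
  by have := enormD (w - z) z; rewrite subrK; lra.
have [mhi mhi0 mhiP] := run_mubar_bounds.
exists (b1 * (mhi * (D + D)) `^ sigma); first by rewrite mulr_ge0 ?powR_ge0 ?ltW.
move=> k; rewrite /ek ler_pM2l//; have /andP[m1 m2] := mhiP k.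
have m0 : 0 <= mubar k by rewrite (le_trans _ m1)// ltW.
have xx : enorm (mubar k *: (x k - xbar k)) <= mhi * (D + D).
  rewrite enormZ ger0_norm// ler_pM ?enorm_ge0//.
  rewrite (le_trans (enormD _ _))// enormN lerD// DP//; first exact: run_box.
  exact: run_xbar_box.
apply: ge0_ler_powR => //; rewrite ?nnegrE ?enorm_ge0 ?(ltW sigma_gt0)//.
by rewrite (le_trans (enorm_ge0 _) xx).
Qed.

Lemma has_grad_model (a : R) (z v : 'cV[R]_n) (M : 'M[R]_n) : M^T = M ->
  has_grad (fun w => a + dotp v (w - z) + 1 / 2 * dotp (w - z) (M *m (w - z)))
    (fun w => v + M *m (w - z)).
Proof.
move=> Msym w e e0; have M1 : 0 < fnorm M + 1 by rewrite ltr_wpDl ?fnorm_ge0.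
exists (e / (fnorm M + 1)); split=> [|h]; first by rewrite divr_gt0.
rewrite ltr_pdivlMr// => he; rewrite (addrAC w h).
have -> : a + dotp v (w - z + h) + 1 / 2 * dotp (w - z + h) (M *m (w - z + h)) -
    (a + dotp v (w - z) + 1 / 2 * dotp (w - z) (M *m (w - z))) -
    dotp (v + M *m (w - z)) h = 1 / 2 * dotp (M *m h) h.
  move: (w - z) => c; rewrite mulmxDr !dotp_lin.
  have -> : dotp h (M *m c) = dotp (M *m c) h by rewrite dotpC.
  have -> : dotp c (M *m h) = dotp (M *m c) h by rewrite dotp_adj Msym.
  by rewrite (dotpC h (M *m h)); field.
rewrite normrM ger0_norm; last by lra.
have := dotp_abs (M *m h) h; have := ler_wpM2r (enorm_ge0 h) (enorm_mulmx M h).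
have := normr_ge0 (dotp (M *m h) h); have := ler_wpM2r (enorm_ge0 h) (ltW he).
by have := enorm_ge0 h; have := sqr_ge0 (enorm h); rewrite expr2; lra.
Qed.

Lemma model_grad_continuous (z v w : 'cV[R]_n) (M : 'M[R]_n) (e : R) : 0 < e ->
  exists2 r : R, 0 < r & forall w', enorm (w' - w) < r ->
    enorm (v + M *m (w' - z) - (v + M *m (w - z))) < e.
Proof.
move=> e0; have M1 : 0 < fnorm M + 1 by rewrite ltr_wpDl ?fnorm_ge0.
exists (e / (fnorm M + 1)) => [|w']; first by rewrite divr_gt0.
rewrite ltr_pdivlMr// => h.
have -> : v + M *m (w' - z) - (v + M *m (w - z)) = M *m (w' - w).
  by rewrite opprD addrACA subrr add0r -mulmxBr opprB addrA subrK.
by have := enorm_mulmx M (w' - w); have := enorm_ge0 (w' - w); lra.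
Qed.

Hypothesis x_xbar : forall k, x k <> xbar k.
Hypothesis Gspec : exists2 M : R, 0 < M &
  newton_matrix_spec hessf l u b1 sigma x xbar mubar G M.

Lemma run_newton_steps K :
  (forall k, (K <= k)%N -> PiSet B l u (x k) = PiSet B l u (x K)) ->
  exists (mhi M : R) (eta : nat -> 'cV[R]_n), [/\ 0 < mhi, 0 < M,
    forall k, mumin <= mubar k <= mhi &
    forall k, (K <= k)%N -> newton_step f gradf hessf (PiSet B l u (x K))
      b1 sigma varsigma rho beta mumin mhi M
      (x k) (x k.+1) (xbar k) (y k) (eta k) (G k) (mubar k) (tt k)].
Proof.
move=> PK; have [mhi mhi0 mhiP] := run_mubar_bounds.
have [M M0 GM] := Gspec; have [E E0 EP] := run_ek_bounded.
suff ex k : exists eta, (K <= k)%N -> newton_step f gradf hessf (PiSet B l u (x K))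
    b1 sigma varsigma rho beta mumin mhi (M + E)
    (x k) (x k.+1) (xbar k) (y k) eta (G k) (mubar k) (tt k).
  have [eta etaP] := choice ex; exists mhi, (M + E), eta; split=> //.
  by rewrite ltr_wpDr.
have [Kk|nKk] := boolP (K <= k)%N; last by exists 0.
have nk := run_eventually_newton PK Kk.
have [_ /(_ k)[_ _ _ _]] := run; rewrite -/(newton k) nk => -[Th dist dE [ls lsmin] xS].
have xb := run_box k; have Cx := PiSet_self B xb.
have [Gsym Gq] := GM k xb; have /andP[m1 _] := mhiP k.
have m0 : 0 < mubar k by exact: lt_le_trans m1.
set r := mubar k *: (x k - xbar k) in dist.
have N0 : 0 < enorm r.
  apply: enorm_gt0 => /eqP; rewrite scaler_eq0 gt_eqF//= subr_eq0 => /eqP.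
  exact: x_xbar.
pose q := Num.min (enorm r) (enorm r `^ (1 + varsigma)).
have q0 : 0 < q by rewrite lt_min N0 powR_gt0.
(* The test has factor 1/2 times a minimum that is at most 1; relaxing it to 3/4 leaves the strict
   slack needed to pick an actual subgradient. *)
have [|v vS vq] := dist0_lt (c' := 3 / 4 * q) dist.
  rewrite -/q; have : Num.min (mubar k)^-1 1 * q <= 1 * q.
    by rewrite ler_pM2r// ge_min lexx orbT.
  by rewrite mulrAC; lra.
have vN := lim_sub_indic (@PiSet_convex _ _ _ _ _ _ _) (has_grad_model _ _ _ Gsym)
  (fun e e0 => model_grad_continuous _ _ _ _ e0) vS.
have [Cy mod_le] := indic_plus_le Cx Th.
have /andP[/eqP s1 /eqP s2] := nk.
exists v => _; rewrite -(PK k Kk); split=> //.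
- by rewrite -dE.
- by rewrite xS -dE.
- by move=> s st; rewrite -dE; exact: lsmin.
- by move: vN; rewrite opprD addrA.
- exact: prox_normal_cone xb (run_prox k) s1 s2.
- by rewrite (le_trans (ltW vq))// ler_pM2l// ge_min lexx.
- by rewrite (le_trans (ltW vq))// ler_pM2l// ge_min lexx orbT.
- by move=> w; have [] := Gq w.
- by move=> w; have [] := Gq w.
- move=> w; have [_ _ /le_trans] := Gq w; apply.
  by rewrite ler_wpM2r ?enorm_ge0// lerD2l.
- move: mod_le; rewrite subrr dotp0l dotp0r mulr0 !addr0.
  by rewrite (dotpC (y k - x k) (G k *m _)); lra.
Qed.

End Run.

(** Passes from the extended-valued inequality to a real one, replacing the distance to the
    subdifferential by the norm of the particular subgradient [gradf x + xi]. *)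
Lemma KL_indic {R : realType} {n : nat} (C : set 'cV[R]_n) (f : 'cV[R]_n -> R) gradf
    (eta : \bar R) (phi : R -> R) xs x xi :
  has_grad f gradf -> C xs -> normal_cone C x xi -> (0 < eta)%E -> f xs < f x ->
  0 < derive1 phi (f x - f xs) -> ((f x - f xs)%:E < eta)%E ->
  (let h := indic_plus C f in (h xs < h x)%E -> (h x < h xs + eta)%E ->
    (1 <= (derive1 phi (fine (h x - h xs)))%:E * dist0 (lim_sub h x))%E) ->
  1 <= derive1 phi (f x - f xs) * enorm (gradf x + xi).
Proof.
move=> fg Cxs xiN eta0 fx dphi seta /=; have [Cx _] := xiN.
have dist := dist0_le (mem_lim_sub_indic fg xiN); move: dist.
set S := lim_sub _ _; rewrite /indic_plus (mem_set Cx) (mem_set Cxs) => dist KL.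
have {}KL : (1 <= (derive1 phi (f x - f xs))%:E * dist0 S)%E.
  apply: KL; first by rewrite lte_fin.
  case: (eta) eta0 seta => [e _||//].
    by rewrite -EFinD !lte_fin ltrBlDl.
  by move=> _ _; rewrite addey// ltry.
rewrite -lee_fin EFinM; apply: (le_trans KL).
by rewrite lee_pmul2l// lte_fin.
Qed.

(** Division by zero returns 0, so the positive lower bound [c] already rules out [b = 0]. *)
Lemma angle_condition {R : realType} (a b c : R) : 0 < c -> 0 <= b -> c <= a / b -> c * b <= a.
Proof.
move=> c0 b0; have [->|bn] := eqVneq b 0; first by rewrite invr0 mulr0 leNgt c0.
by rewrite ler_pdivlMr// lt0r bn.
Qed.

Theorem theorem5p5 (R : realType) (n p : nat) (B : 'M[R]_(p, n)) (lam1 lam2 : R)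
  (l u : 'cV[R]_n) (f : 'cV[R]_n -> R) (gradf : 'cV[R]_n -> 'cV[R]_n)
  (hessf : 'cV[R]_n -> 'M[R]_n)
  (mumin mumax tau alpha b1 b2 rho sigma varsigma beta : R)
  (x xbar y d : nat -> 'cV[R]_n) (mu mubar : nat -> R) (mm tt : nat -> nat)
  (G : nat -> 'M[R]_n) (Pistar : set 'cV[R]_n) :
  0 < lam1 -> 0 < lam2 -> (forall i, l i 0 <= 0 <= u i 0) ->
  C2_with f gradf hessf ->
  0 < mumin -> mumin < mumax -> 1 < tau -> 0 < alpha -> 0 < b1 -> 1 <= b2 ->
  0 < rho < 1 / 2 -> 0 < sigma < 1 / 2 -> sigma < varsigma <= 1 -> 0 < beta < 1 ->
  PGiPN_run B lam1 lam2 l u f gradf mumin mumax tau alpha rho varsigma beta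
    x xbar y d mu mubar mm tt G ->
  (Gchoice1 hessf b1 b2 sigma x xbar mubar G \/
   exists (q : nat) (A : 'M[R]_(q, n)) (b : 'cV[R]_q) (hs hs1 hs2 : 'I_q -> R -> R),
     sep_composite f A b hs hs1 hs2 /\
     (Gchoice2 hessf A b hs2 b1 b2 sigma x xbar mubar G \/
      Gchoice3 A b hs2 b1 sigma x xbar mubar G)) ->
  (forall k, x k <> xbar k) ->
  (exists K, forall k, (K <= k)%N -> PiSet B l u (x k) = Pistar) ->
            
  loc_lip_near hessf (accum_points x) ->
            
  (forall xs, accum_points x xs ->
     exists xi, rel_int (normal_cone Pistar xs) xi /\ gradf xs + xi = 0) ->
            
  (exists (K : nat) (xi : nat -> 'cV[R]_n),
     (forall k, (K <= k)%N -> normal_cone Pistar (x k) (xi k)) /\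
     (0 < limn_einf (fun k =>
        ((- dotp (gradf (x k) + xi k) (d k)) /
         (enorm (gradf (x k) + xi k) * enorm (d k)))%:E))%E) ->
  KL_function (indic_plus Pistar f) ->
  ((\sum_(1 <= k <oo) (enorm (x k.+1 - x k))%:E < +oo)%E /\
   exists xs, vconv x xs /\ Lstationary f gradf (gfun B lam1 lam2 l u) xs).
Proof.
move=> lam1_gt0 lam2_gt0 lu C2 mumin_gt0 _ tau_gt1 alpha_gt0 b1_gt0 b2_ge1 rho_int
  sigma_int /andP[varsigma_gt _] beta_int run Gch x_xbar [K PK] A1 A2 [K' [xi [xiN A3]]] KLf.
have [fg [gH _]] := C2; have /andP[sigma_gt0 _] := sigma_int.
have box0 : box l u 0 by move=> i; rewrite mxE; exact: lu.
have Gspec : exists2 M : R, 0 < M & newton_matrix_spec hessf l u b1 sigma x xbar mubar G M.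
  case: Gch => [G1|[q [A [b [hs [hs1 [hs2 [sep [G2|G3]]]]]]]]].
  - exact: (Gchoice1_spec C2 l u b1_gt0 b2_ge1 G1).
  - exact: (Gchoice2_spec C2 l u b1_gt0 b2_ge1 sep G2).
  - exact: (Gchoice3_spec C2 l u b1_gt0 sep G3).
have PstarE := PK K (leqnn K); rewrite -{Pistar}PstarE in PK A2 xiN KLf.
have [mhi [M [eta [mhi0 M0 mP steps]]]] := run_newton_steps lam1_gt0 lam2_gt0 box0 C2
  mumin_gt0 tau_gt1 alpha_gt0 b1_gt0 sigma_gt0 beta_int run x_xbar Gspec PK.
have dE := run_direction box0 beta_int run PK.
have xbox := run_box box0 beta_int run.
(* Any accumulation point will do; it turns out to be the limit. *)
have [xs xs_acc] := bounded_accum_points xbox.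
have xsC : PiSet B l u (x K) xs.
  apply: PiSet_closed => e e0; have [k [Kk kx]] := xs_acc e e0 K.
  by exists (x k) => //; rewrite -(PK k Kk); apply: PiSet_self; exact: xbox.
have [L L0 HL] := hessian_bounded C2 l u.
have [W [_ [OS Olip]]] := A1; have [r1 [Lz [r10 HLz]]] := Olip xs (OS xs xs_acc).
have gri : rel_int (normal_cone (PiSet B l u (x K)) xs) (- gradf xs).
  have [v [vri /eqP]] := A2 xs xs_acc.
  by rewrite addrC addr_eq0 => /eqP <-.
have [c c0 cP] := limn_einf_gt0 A3.
have xiN' : \forall k \near \oo, normal_cone (PiSet B l u (x K)) (x k) (xi k).
  by exists K' => // k /=; exact: xiN.
have ang : \forall k \near \oo, c * (enorm (gradf (x k) + xi k) * enorm (y k - x k)) <=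
    - dotp (gradf (x k) + xi k) (y k - x k).
  apply: filterS2 (nbhs_infty_ge K) cP => k Kk; rewrite dE//.
  by apply: angle_condition => //; rewrite mulr_ge0 ?enorm_ge0.
have [r2 r20 desc] := eventual_descent C2 HL b1_gt0 sigma_int varsigma_gt rho_int beta_int
  mumin_gt0 mhi0 (ltW M0) L0 steps xs_acc r10 HLz gri xiN' ang.
(* The point [xs] lies in the domain of the subdifferential because 0 is normal there, so [gradf xs]
   is a limiting subgradient. *)
have [e [r3 [phi [e0 [r30 [ups KL]]]]]] : KL_at (indic_plus (PiSet B l u (x K)) f) xs.
  apply: KLf; exists (gradf xs + 0); apply: mem_lim_sub_indic => //.
  by split=> // z _; rewrite dotp0l.
have gt_lim := values_gt_limit C2 b1_gt0 rho_int beta_int mumin_gt0 mhi0 (ltW M0) steps xs_acc.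
pose s k := f (x k) - f xs; pose D k := enorm (gradf (x k) + xi k).
have s_gt0 : \forall k \near \oo, 0 < s k.
  by exists K => // k /= Kk; rewrite subr_gt0; exact: gt_lim.
have s_cvg : forall h : R, 0 < h -> \forall k \near \oo, s k < h.
  exact: (values_cvg C2 b1_gt0 rho_int beta_int mumin_gt0 mhi0 (ltW M0) steps xs_acc).
have r0 : 0 < Num.min r2 r3 by rewrite lt_min r20.
have KLs : \forall k \near \oo, enorm (x k - xs) < Num.min r2 r3 -> ((s k)%:E < e)%E ->
    1 <= derive1 phi (s k) * D k.
  apply: filterS2 (nbhs_infty_ge K) xiN' => k Kk xik; rewrite lt_min => /andP[_ xk] sk.
  have fk := gt_lim k Kk; have [_ [_ [_ [_ [_ [_ dpos]]]]]] := ups.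
  apply: (KL_indic fg xsC xik e0 fk) => //; last exact: KL.
  by apply: dpos; split=> //; rewrite subr_gt0.
have desc' : \forall k \near \oo, enorm (x k - xs) < Num.min r2 r3 ->
    rho * c * (D k * enorm (x k.+1 - x k)) <= s k - s k.+1.
  apply: filterS desc => k dk; rewrite lt_min => /andP[/dk + _].
  by rewrite (_ : s k - s k.+1 = f (x k) - f (x k.+1))//; rewrite /s; ring.
have rc0 : 0 < rho * c by case/andP: rho_int => rho0 _; rewrite mulr_gt0.
have xsx := KL_vconv ups e0 rc0 r0 xs_acc s_gt0 s_cvg KLs desc'.
split; first exact: (KL_summable ups e0 rc0 r0 xs_acc s_gt0 s_cvg KLs desc').
exists xs; split=> //.
apply: (Lstationary_limit lam1_gt0 lam2_gt0 f gH mhi0 (PiSet_box xsC) xsx _ _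
  (run_prox run)).
(* The residual carries the factor [mubar k >= mumin], so it controls the distance from [xbar k] to
   [x k]. *)
- move=> h h0; have := residual_cvg0 C2 HL b1_gt0 sigma_int rho_int beta_int mumin_gt0 mhi0
    (ltW M0) L0 steps xs_acc (mulr_gt0 mumin_gt0 h0).
  apply: filterS => k; have /andP[m1 _] := mP k.
  rewrite enormZ gtr0_norm ?(lt_le_trans mumin_gt0)// (enormB (x k)) => Nk.
  rewrite -(ltr_pM2l mumin_gt0); apply: le_lt_trans Nk.
  by rewrite ler_wpM2r ?enorm_ge0.
- by apply: nearW => k; have /andP[m1 ->] := mP k; rewrite (lt_le_trans mumin_gt0).
Qed.
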